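(* Let $\ell\geq5$ be an integer, let $G$ be a graph with girth $2\ell+1$ and no odd hole of length at least $2\ell+3$, and suppose $G$ has an odd hole $C$. Then at least one of the following holds: (1) $G$ has an odd $K_4$-subdivision; (2) $G$ contains a balanced $K_4$-subdivision of type $(1,2)$; (3) $G$ has a $P_3$-cut; (4) $G$ has a vertex of degree $2$.
   Context: Graphs are finite and simple; $|F|$ is the number of edges of a path $F$. A hole is an induced cycle of length at least four; odd/even according to its length. A $P_3$-cut of $G$ is a path $P$ of $G$ with exactly three vertices such that $G-V(P)$ is disconnected. For a graph $H$ isomorphic to a subdivision of $K_4$, an arris is a path of $H$ whose ends are degree-3 vertices and which contains exactly two degree-3 vertices; the face cycles are the four cycles each formed by three arrises joining three of the four degree-3 vertices. $G$ has an odd $K_4$-subdivision if some subgraph of $G$ isomorphic to a subdivision of $K_4$ has all four face cycles odd holes of $G$. $G$ contains a balanced $K_4$-subdivision of type $(1,2)$ if $G$ has an induced subgraph $H$ isomorphic to a subdivision of $K_4$ whose degree-3 vertices and arrises can be labelled $u_1,\dots,u_4$ and $P_1$ ($u_1u_2$), $P_2$ ($u_3u_4$), $Q_1$ ($u_2u_3$), $Q_2$ ($u_1u_4$), $L_1$ ($u_1u_3$), $L_2$ ($u_2u_4$) (ends in parentheses) such that $P_1\cup Q_1\cup L_1$ and $P_1\cup Q_2\cup L_2$ are odd holes of $G$, $P_2\cup Q_1\cup L_2$ and $P_2\cup Q_2\cup L_1$ are even holes of $G$, $|Q_1|=1$ and $|L_2|>1$. *)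

(* Defs.v *)
From mathcomp Require Import all_boot.

Set Implicit Arguments.
Unset Strict Implicit.
Unset Printing Implicit Defensive.

(* Finite simple graphs whose vertices form a subset of an ambient finite type,
   so that a graph and its subgraphs live over the same type. *)
Record sgraph (T : finType) := SGraph {
  verts : {set T};
  adj : rel T;
  adj_sym : symmetric adj;
  adj_irr : irreflexive adj;
  adj_verts : forall x y, adj x y -> x \in verts }.

Section Graphs.

Variable T : finType.
Implicit Types (G H : sgraph T) (A : {set T}) (x y z : T) (s c : seq T).

Definition deg G x : nat := #|[set y | adj G x y]|.

Definition subgraph H G : Prop :=
  verts H \subset verts G /\ subrel (adj H) (adj G).

Definition induced_adj G A : rel T :=
  [rel x y | [&& x \in A, y \in A & adj G x y]].

Lemma induced_adj_sym G A : symmetric (induced_adj G A).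
Proof. by move=> x y; rewrite /induced_adj /= adj_sym andbCA. Qed.

Lemma induced_adj_irr G A : irreflexive (induced_adj G A).
Proof. by move=> x; rewrite /induced_adj /= adj_irr !andbF. Qed.

Lemma induced_adj_verts G A x y :
  induced_adj G A x y -> x \in verts G :&: A.
Proof. by case/and3P=> xA _ /adj_verts xG; rewrite inE xG. Qed.

Definition induced G A : sgraph T :=
  SGraph (induced_adj_sym G A) (induced_adj_irr G A) (@induced_adj_verts G A).

Definition del_verts G A : sgraph T := induced G (~: A).

Definition disconnected G : Prop :=
  exists x y, [/\ x \in verts G, y \in verts G & ~~ connect (adj G) x y].

(* A path is given by the sequence of its vertices, from x to y. *)
Definition gpath G x y s : bool :=
  [&& s != [::], head x s == x, last x s == y, uniq s,
      all [in verts G] s & sorted (adj G) s].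

Definition path_len s : nat := (size s).-1.

(* A cycle is given by the cyclic sequence of its vertices; its length is
   [size c]. *)
Definition gcycle G c : bool :=
  [&& 3 <= size c, uniq c & cycle (adj G) c].

Definition has_girth G (g : nat) : Prop :=
  (exists c, gcycle G c /\ size c = g) /\
  (forall c, gcycle G c -> g <= size c).

Definition hole G c : Prop :=
  [/\ gcycle G c, 4 <= size c &
      {in c &, forall x y, adj G x y -> y = next c x \/ x = next c y}].

Definition odd_hole G c : Prop := hole G c /\ odd (size c).
Definition even_hole G c : Prop := hole G c /\ ~~ odd (size c).

Definition has_P3_cut G : Prop :=
  exists x y s, [/\ gpath G x y s, size s = 3 &
                    disconnected (del_verts G [set v in s])].

(* H is isomorphic to a subdivision of K: u gives the branch vertices, and
   p x y is the path of H, read from u x to u y, that replaces the edge xy. *)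
Definition is_subdivision (S : finType) (K : sgraph S) H : Prop :=
  exists (u : S -> T) (p : S -> S -> seq T),
    [/\ {in verts K &, injective u},
        forall a b, adj K a b ->
          gpath H (u a) (u b) (p a b) /\ p b a = rev (p a b),
        (forall a b w, adj K a b -> w \in verts K -> u w \in p a b ->
          w = a \/ w = b) /\
        (forall a b a' b' z, adj K a b -> adj K a' b' ->
          z \in p a b -> z \in p a' b' ->
          [set a; b] = [set a'; b'] \/ z \in u @: verts K),
        forall z, z \in verts H <->
          z \in u @: verts K \/ exists a b, adj K a b /\ z \in p a b &
        forall x y, adj H x y <->
          exists a b, adj K a b /\ infix [:: x; y] (p a b)].

Definition deg3 H x : bool := deg H x == 3.

Definition arris H x y s : Prop :=
  [/\ gpath H x y s, deg3 H x, deg3 H y & count (deg3 H) s = 2].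

(* The closed sequence P1 u P2 u P3 for paths P1 from x to y, P2 from y to z
   and P3 from z to x. *)
Definition join3 s1 s2 s3 : seq T := behead s1 ++ behead s2 ++ behead s3.

Definition face_cycle H c : Prop :=
  exists x y z s1 s2 s3,
    [/\ uniq [:: x; y; z], arris H x y s1, arris H y z s2, arris H z x s3 &
        c = join3 s1 s2 s3].

End Graphs.

Lemma neq_sym (T : finType) : symmetric [rel x y : T | x != y].
Proof. by move=> x y; rewrite /= eq_sym. Qed.

Lemma neq_irr (T : finType) : irreflexive [rel x y : T | x != y].
Proof. by move=> x; rewrite /= eqxx. Qed.

Lemma neq_verts (T : finType) (x y : T) :
  [rel x y : T | x != y] x y -> x \in [set: T].
Proof. by rewrite inE. Qed.

Definition complete_graph (T : finType) : sgraph T :=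
  SGraph (@neq_sym T) (@neq_irr T) (@neq_verts T).

Definition K4 : sgraph 'I_4 := complete_graph 'I_4.

Definition has_odd_K4_subdivision (T : finType) (G : sgraph T) : Prop :=
  exists H : sgraph T,
    [/\ subgraph H G, is_subdivision K4 H &
        forall c, face_cycle H c -> odd_hole G c].

(* Arrises are read from their first to their second listed end, hence the
   reversals when three of them are joined into a cycle. *)
Definition has_balanced_K4_subdivision_12 (T : finType) (G : sgraph T) : Prop :=
  exists A : {set T}, let H := induced G A in
    is_subdivision K4 H /\
    exists (u1 u2 u3 u4 : T) (P1 P2 Q1 Q2 L1 L2 : seq T),
      [/\ uniq [:: u1; u2; u3; u4],
          [/\ arris H u1 u2 P1, arris H u3 u4 P2, arris H u2 u3 Q1 &
           [/\ arris H u1 u4 Q2, arris H u1 u3 L1 & arris H u2 u4 L2]],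
          odd_hole G (join3 P1 Q1 (rev L1)) /\
          odd_hole G (join3 P1 L2 (rev Q2)),
          even_hole G (join3 P2 (rev L2) Q1) /\
          even_hole G (join3 P2 (rev Q2) L1) &
          path_len Q1 = 1 /\ 1 < path_len L2].

(* Main.v *)
(** Suppose none of the four conclusions holds, and write n = 2l+1, so that every
odd hole has length n.

An induced path r that joins two nonadjacent vertices s, t of an odd hole C and
is otherwise anticomplete to C makes a theta with C.  One of the two cycles that
r forms with the arcs of C is an odd hole, so r is as long as one of the arcs,
and the even cycle shows that this is the longer one.  Choose such a theta with
r as short as possible, and a vertex y near the end of r.  As y has degree at
least 3 and the subpath of r centred at y is not a P3-cut, some path leaves r
near y and returns to the theta.  If it returns to C, then a K4-subdivision with
odd face C arises, and comparing lengths makes it odd or balanced of type (1,2).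
If it returns to r, it can replace a part of r of the same length, and is then a
shorter jump over the odd hole formed by r and the shorter arc.  So there are no
thetas.

Without thetas, the same argument at a vertex y of C produces only local jumps:
paths from y to a vertex at distance two whose attachments on C are the two ends
and the vertex between them.  Two local jumps at distant places are anticomplete
(otherwise a theta arises).  Replacing one middle vertex by its jump must give an
even hole, hence replacing both gives an odd hole that is too long. *)
Require Import Defs.
From mathcomp Require Import all_boot zify.
From Stdlib Require Import Classical.

Set Implicit Arguments.
Unset Strict Implicit.
Unset Printing Implicit Defensive.

(** * Induced paths and holes *)

Section InducedPaths.

Variables (T : finType) (G : sgraph T).
Implicit Types (x y z : T) (s c : seq T).

(** Distinctness is part of the relation, so that [allrel far s1 s2] makes [s1] and [s2] disjoint
    and anticomplete at once. *)
Definition far x y : bool := (x != y) && ~~ adj G x y.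

(** Each vertex is compared only with later ones; as [far] is symmetric this describes induced
    paths, and repeated vertices are excluded automatically. *)
Fixpoint ipath s : bool :=
  if s is x :: s1 then
    (if s1 is y :: s2 then adj G x y && all (far x) s2 else true) && ipath s1
  else true.

Lemma farC x y : far x y = far y x.
Proof. by rewrite /far eq_sym adj_sym. Qed.

Lemma allrel_farC s1 s2 : allrel far s1 s2 = allrel far s2 s1.
Proof.
rewrite allrelC; apply: eq_allrel => x y; exact: farC.
Qed.

Lemma all_far_notin x s : all (far x) s -> x \notin s.
Proof. by move=> h; apply/negP=> /(allP h); rewrite /far eqxx. Qed.

Lemma allrel_far_disjoint s1 s2 x : allrel far s1 s2 -> x \in s1 -> x \notin s2.
Proof. by move=> /allrelP h x1; apply/negP=> x2; have := h _ _ x1 x2; rewrite /far eqxx. Qed.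

Lemma adj_neq x y : adj G x y -> x != y.
Proof. by apply: contraTneq => ->; rewrite adj_irr. Qed.

Lemma ipath_cons2 x y s :
  ipath [:: x, y & s] = [&& adj G x y, all (far x) s & ipath (y :: s)].
Proof. by rewrite andbA. Qed.

(** The basic tool for cutting and gluing: [x] stays in both pieces, so only pairs strictly on
    opposite sides of [x] remain to be compared. *)
Lemma ipath_cat s1 x s2 :
  ipath (s1 ++ x :: s2) =
  [&& ipath (rcons s1 x), ipath (x :: s2) & allrel far s1 s2].
Proof.
elim: s1 => [|y [|z s1] IH]; first by rewrite cat0s allrel0l andbT.
  by rewrite cat1s ipath_cons2 allrel1l [ipath (rcons _ _)]/= !andbT (andbC (all _ _)).
rewrite 2!cat_cons 2!rcons_cons 2!ipath_cons2 -cat_cons -rcons_cons IH.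
rewrite [allrel _ (_ :: _ :: _) _]allrel_consl all_cat all_rcons [all _ (x :: _)]/=.
move: (ipath (rcons (z :: s1) x)) (ipath (x :: s2)) (allrel far (z :: s1) s2) => b1 b2 b3.
by case: (adj G y z); case: (all (far y) s1); case: (far y x); case: (all (far y) s2);
   rewrite ?andbF ?andbT ?andTb ?andFb ?andbF ?andbT; case: b1; case: b2; case: b3.
Qed.

Lemma ipath_rev s : ipath (rev s) = ipath s.
Proof.
elim: s => [|x [|y s] IH] //.
rewrite 2!rev_cons -!cats1 -catA cat1s ipath_cat ipath_cons2 -rev_cons IH ipath_cons2.
rewrite allrel1r all_rev /= andbT adj_sym.
rewrite (eq_all (a2 := far x)); last by move=> z; exact: farC.
by case: (adj G x y); rewrite ?andbF //= andbC.
Qed.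

Lemma ipath_uniq s : ipath s -> uniq s.
Proof.
elim: s => [|x [|y s] IH] //; rewrite ipath_cons2 => /and3P[xy xs ys].
rewrite cons_uniq IH // inE negb_or adj_neq //= andbT; exact: all_far_notin.
Qed.

Lemma ipath_sorted s : ipath s -> sorted (adj G) s.
Proof.
elim: s => [|x [|y s] IH] //; rewrite ipath_cons2 => /and3P[xy xs ys].
by rewrite /= xy; exact: IH.
Qed.

Lemma ipath_catl s1 s2 : ipath (s1 ++ s2) -> ipath s1.
Proof.
elim: s1 => [|x [|y s1] IH] // ; rewrite 2!cat_cons ipath_cons2 all_cat.
by case/and3P=> xy /andP[xs1 _] /IH ys1; rewrite ipath_cons2 xy xs1.
Qed.

Lemma ipath_catr s1 s2 : ipath (s1 ++ s2) -> ipath s2.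
Proof. by elim: s1 => // x s IH /= /andP[_]. Qed.

Lemma ipath_adj s x y :
  ipath s -> x \in s -> y \in s -> adj G x y ->
  infix [:: x; y] s || infix [:: y; x] s.
Proof.
have key a : forall b, ipath (a :: b) -> forall v, v \in b -> adj G a v ->
    infix [:: a; v] (a :: b).
  case=> // z b; rewrite ipath_cons2 => /and3P[_ ab _] v.
  rewrite inE => /orP[/eqP-> _|vb av]; first by rewrite /= !eqxx prefix0s.
  by move/(allP ab): vb; rewrite /far av andbF.
elim: s => // a s IH ips xs ys xy.
have ips' : ipath s by move: ips; rewrite /= => /andP[].
move: xs ys; rewrite !inE => /orP[/eqP xa|xs] /orP[/eqP ya|ys].
- by rewrite xa ya adj_irr in xy.
- by rewrite xa in xy *; rewrite key.
- by rewrite ya in xy *; rewrite orbC key // adj_sym.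
- by case/orP: (IH ips' xs ys xy) => h; rewrite (infix_trans h (infix_cons _ _)) ?orbT.
Qed.

Lemma next_cat s1 x y s2 :
  uniq (s1 ++ [:: x, y & s2]) -> next (s1 ++ [:: x, y & s2]) x = y.
Proof. by move=> u; rewrite -(next_rot (size s1) u) rot_size_cat /= eqxx. Qed.

Lemma next_infix x y c : uniq c -> infix [:: x; y] c -> next c x = y.
Proof. by move=> u /infixP[s1 [s2 e]]; move: u; rewrite e; exact: next_cat. Qed.

Lemma hole_rot k c : hole G c -> hole G (rot k c).
Proof.
case=> /and3P[c3 cu cc] c4 ch; split; rewrite ?size_rot //.
  by rewrite /gcycle size_rot c3 rot_uniq cu rot_cycle.
by move=> x y; rewrite !mem_rot => xc yc /(ch _ _ xc yc); rewrite !next_rot.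
Qed.

Lemma hole_rotC s1 s2 : hole G (s1 ++ s2) -> hole G (s2 ++ s1).
Proof. by move/(hole_rot (size s1)); rewrite rot_size_cat. Qed.

Lemma hole_rev c : hole G c -> hole G (rev c).
Proof.
case=> /and3P[c3 cu cc] c4 ch; split; rewrite ?size_rev //.
  rewrite /gcycle size_rev c3 rev_uniq cu rev_cycle /=.
  by rewrite (eq_cycle (e' := adj G)) // => x y; rewrite adj_sym.
move=> x y; rewrite !mem_rev => xc yc /(ch _ _ xc yc) [->|->]; rewrite !next_rev //.
  by right; rewrite prev_next.
by left; rewrite prev_next.
Qed.

Lemma hole_uniq c : hole G c -> uniq c.
Proof. by case=> /and3P[]. Qed.

(** Leaving out [x] keeps the closing edge of the hole away from [s]: in the whole list, every
    vertex of [s] is followed by a vertex other than the first. Rotation by one moves the first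
    vertex behind [x] and gives the induction. *)
Lemma hole_ipath s x s' : hole G (s ++ x :: s') -> ipath s.
Proof.
elim: s x s' => // y s IH x s' h.
have ips : ipath s.
  by move/(hole_rot 1): h; rewrite cat_cons rot1_cons rcons_cat rcons_cons => /IH.
case: s {IH} h ips => [|z s] // [/and3P[_ u cy] _ ch] ips.
rewrite ipath_cons2 ips andbT; apply/andP; split.
  by move: cy; rewrite /= => /andP[].
apply/allP=> w ws.
have wc : w \in z :: s by rewrite inE ws orbT.
have yw : y != w.
  apply: contraTneq ws => <-; move: u; rewrite /= inE mem_cat !negb_or.
  by case/andP=> /and3P[].
rewrite /far yw; apply/negP=> a.
have wC : w \in (y :: z :: s) ++ x :: s' by rewrite !inE mem_cat ws !orbT.
have yC : y \in (y :: z :: s) ++ x :: s' by rewrite !inE eqxx.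
case: (ch _ _ yC wC a) => [e|].
  have ew : w = z by rewrite e /= eqxx.
  by move: u; rewrite ew in ws; rewrite /= mem_cat ws andbF.
rewrite next_nth wC cat_cons => e.
move: u; rewrite cons_uniq => /andP[/negP[]].
rewrite {1}e; apply: mem_nth.
have -> : index w (y :: (z :: s) ++ x :: s') = (index w ((z :: s) ++ x :: s')).+1.
  by rewrite /= (negbTE yw).
rewrite index_cat wc size_cat [size (x :: _)]/=.
by move: wc; rewrite -index_mem; move: (index _ _) (size _) => *; lia.
Qed.


Lemma gcycle_of_ipath x y s z :
  ipath (y :: rcons s z) -> adj G x y -> adj G x z -> all (far x) s ->
  gcycle G [:: x, y & rcons s z].
Proof.
move=> ip xy xz xs; rewrite /gcycle /= size_rcons /=.
have /= -> := ipath_uniq ip; rewrite inE negb_or mem_rcons inE negb_or.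
rewrite adj_neq // adj_neq // all_far_notin //= xy.
by rewrite rcons_path last_rcons adj_sym xz andbT; exact: (ipath_sorted ip).
Qed.

Lemma hole_of_ipath x y s z :
  3 < size [:: x, y & rcons s z] ->
  ipath (y :: rcons s z) -> adj G x y -> adj G x z -> all (far x) s ->
  hole G [:: x, y & rcons s z].
Proof.
move=> c4 ip xy xz xs; have gc := gcycle_of_ipath ip xy xz xs.
split=> //; case/and3P: gc => _ u _.
have nz : next [:: x, y & rcons s z] z = x.
  have e : rot 1 [:: x, y & rcons s z] = (y :: s) ++ [:: z; x].
    by rewrite rot1_cons -!cats1 -cat_cons -catA.
  by rewrite -(next_rot 1 u) e next_cat // -e rot_uniq.
have ny : next [:: x, y & rcons s z] x = y by rewrite /= eqxx.
have nx a b : infix [:: a; b] (y :: rcons s z) -> next [:: x, y & rcons s z] a = b.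
  by move=> h; apply: next_infix => //; exact: infix_trans h (infix_cons _ _).
have key v : v \in y :: rcons s z -> adj G x v ->
    v = next [:: x, y & rcons s z] x \/ x = next [:: x, y & rcons s z] v.
  rewrite inE mem_rcons inE => /or3P[/eqP->|/eqP->|vs] xv; [by left|by right|].
  by move/(allP xs): vs; rewrite /far xv andbF.
move=> a b; rewrite ![_ \in _ :: _ :: _]in_cons -!in_cons.
move=> /orP[/eqP->|ac] /orP[/eqP->|bc]; first by rewrite adj_irr.
- exact: key.
- by rewrite adj_sym => /(key _ ac) []; [right|left].
- by move=> /(ipath_adj ip ac bc) /orP[/nx|/nx] ->; [left|right].
Qed.

End InducedPaths.

(** * Arcs of holes and shortest connections *)

Section HolesAndPaths.
Variables (T : finType) (G : sgraph T).
Implicit Types (x y z : T) (s c : seq T).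


Lemma mem_split x s : x \in s -> exists s1 s2, s = s1 ++ x :: s2.
Proof. by case/splitPr=> s1 s2; exists s1, s2. Qed.

(** Each arc with both its ends still misses a vertex of the other arc, so [hole_ipath] applies to
    it after a rotation. Dropping only [x] gives the anticompleteness of the arcs. *)
Lemma hole_split x s1 y s2 :
  hole G (x :: s1 ++ y :: s2) -> s1 != [::] -> s2 != [::] ->
  [/\ ipath G (x :: rcons s1 y), ipath G (y :: rcons s2 x) & allrel (far G) s1 s2].
Proof.
move=> h n1 n2; split.
- case: s2 n2 h => // z s2 _; rewrite -cat_cons -cat_rcons rcons_cons; exact: hole_ipath.
- have := hole_rotC (s1 := x :: s1) h.
  by case: s1 n1 {h} => // z s1 _; rewrite -[x :: _]cat1s catA cats1; exact: hole_ipath.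
- have := hole_rot 1 h; rewrite rot1_cons -cats1 => /hole_ipath.
  by rewrite ipath_cat => /and3P[].
Qed.

Lemma hole_flip x s1 y s2 :
  hole G (x :: s1 ++ y :: s2) -> hole G (x :: rev s2 ++ y :: rev s1).
Proof.
move/hole_rev; rewrite rev_cons -cats1 => /hole_rotC.
by rewrite cat1s rev_cat rev_cons cat_rcons.
Qed.

Lemma hole_pair c x y :
  hole G c -> x \in c -> y \in c -> x != y ->
  exists s1 s2, [/\ hole G (x :: s1 ++ y :: s2), c =i x :: s1 ++ y :: s2
                  & size c = size (x :: s1 ++ y :: s2)].
Proof.
move=> h /rot_to[i s e] yc xy.
have ys : y \in s by move: yc; rewrite -(mem_rot i) e inE eq_sym (negbTE xy).
move: e; case/splitPr: ys => s1 s2 e; exists s1, s2.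
rewrite -e size_rot; split=> //; first exact: hole_rot.
by move=> z; rewrite mem_rot.
Qed.

(** The induced path is built from its far end: when a vertex [v] is put in front, everything before
    the last vertex equal or adjacent to [v] is dropped. *)
Lemma ipath_shorten x s :
  path (adj G) x s ->
  exists2 s', ipath G (x :: s') & {subset s' <= s} /\ last x s' = last x s.
Proof.
have key v : forall r w, ipath G (w :: r) -> has (predC (far G v)) (w :: r) ->
    exists2 r', ipath G (v :: r') & {subset r' <= w :: r} /\ last v r' = last w r.
  elim=> [|a r IH] w ip hw.
    have [e|ne] := eqVneq v w; first by exists [::] => //; rewrite e.
    exists [:: w]; last by split.
    by move: hw; rewrite ipath_cons2 /= orbF /far ne /= negbK => ->.
  have [h|nh] := boolP (has (predC (far G v)) (a :: r)).
    have ip' : ipath G (a :: r) by move: ip; rewrite ipath_cons2 => /and3P[].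
    have [r' h1 [h2 h3]] := IH a ip' h; exists r' => //; split=> // b /h2 ?.
    by rewrite inE orbC; apply/orP; left.
  have far_ar : all (far G v) (a :: r).
    by apply/allP=> b bar; move/hasPn/(_ _ bar): nh; rewrite /= negbK.
  have {}hw : ~~ far G v w by case/orP: hw => // h; case/negP: nh.
  have [e|ne] := eqVneq v w.
    exists (a :: r); first by rewrite e.
    by split=> // b bar; rewrite inE bar orbT.
  exists (w :: a :: r); last by split.
  rewrite ipath_cons2 ip far_ar !andbT.
  by move: hw; rewrite /far ne /= negbK.
elim: s x => [|y s IH] x /=; first by exists [::].
case/andP=> xy /IH[s' ip [sub la]].
have hh : has (predC (far G x)) (y :: s') by rewrite /= /far xy andbF.
have [r ipr [sr lr]] := key x s' y ip hh; exists r => //; split; last by rewrite lr.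
move=> b /sr; rewrite !inE => /orP[->//|/sub ->]; exact: orbT.
Qed.

(** As long as [A] holds again after the start or [B] holds before the end, the path is cut to a
    shorter one. Making it induced afterwards adds no vertices, so both minimality properties
    survive. *)
Lemma path_between (A B D : pred T) x s :
  path (adj G) x s -> all D (x :: s) -> A x -> B (last x s) ->
  exists y r, [/\ ipath G (y :: r), all D (y :: r), A y /\ B (last y r),
                  {in r, forall z, ~~ A z} & {in y :: r, forall z, B z -> z = last y r}].
Proof.
elim: {s}(size s).+1 {-2}s (ltnSn (size s)) x => // n IH s sn x xs Ds Ax Bs.
have [/hasP[z zs Az]|nA] := boolP (has A s).
  move: xs Ds Bs sn; case/splitPr: zs => s1 s2.
  rewrite cat_path /= last_cat all_cat size_cat /= => /and3P[_ _ zs2] /and4P[_ _ Dz Ds2] Bs sn.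
  apply: (IH s2 _ z) => //=; [lia | by rewrite Dz].
(* The index [i] runs over the proper prefixes of [s]; [i = 0] tests the starting vertex [x]
   itself. *)
have [/hasP[i]|nB] := boolP (has (fun i => B (last x (take i s))) (iota 0 (size s))).
  rewrite mem_iota add0n => /andP[_ lti] Bi.
  apply: (IH (take i s) _ x) => //; first by rewrite size_take lti; lia.
    by move: xs; rewrite -{1}(cat_take_drop i s) cat_path => /andP[].
  by move: Ds; rewrite -{1}(cat_take_drop i s) /= all_cat => /and3P[-> ->].
have [r ip [sub la]] := ipath_shorten xs; exists x, r; split=> //.
- move: Ds => /= /andP[-> Ds]; apply/allP=> z /sub; exact: (allP Ds).
- by rewrite la.
- by move=> z /sub zs; move/hasPn: nA => /(_ _ zs).
- move=> z zr Bz; rewrite la.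
  have : z \in x :: s by move: zr; rewrite !inE => /orP[->//|/sub ->]; rewrite orbT.
  move=> zs; case/splitPl: zs Bz nB => s1 [|a s2] e; rewrite ?cats0 ?e // => Bz /hasPn.
  move=> /(_ (size s1)); rewrite mem_iota add0n size_cat /= take_size_cat // e Bz.
  by move=> h; exfalso; move: h; rewrite addnS ltnS leq_addr => /(_ isT).
Qed.
End HolesAndPaths.

(** * Consequences of the girth condition *)

Section Girth.
Variables (T : finType) (G : sgraph T) (l : nat).
Hypothesis l5 : 5 <= l.
Hypothesis girth : forall c, gcycle G c -> 2 * l + 1 <= size c.
Implicit Types (x y z u v w q p t : T) (s c a b m d r : seq T).

Local Notation far := (far G).
Local Notation ipath := (ipath G).

(** Without [x1] the three paths form one induced path of which [x1] sees exactly the two ends, so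
    [hole_of_ipath] applies, with girth supplying the length. The case split is due to [s1] or [s3]
    being possibly empty: the neighbour of [x1] is then [x2] or [x3]. *)
Lemma hole_of_ipaths3 x1 s1 x2 s2 x3 s3 :
  ipath (x1 :: rcons s1 x2) -> ipath (x2 :: rcons s2 x3) ->
  ipath (x3 :: rcons s3 x1) ->
  all (far x3) s1 -> all (far x1) s2 -> all (far x2) s3 ->
  allrel far s1 s2 -> allrel far s2 s3 -> allrel far s1 s3 ->
  hole G (x1 :: s1 ++ x2 :: s2 ++ x3 :: s3).
Proof.
move=> i1 i2 i3 f1 f2 f3 f12 f23 f13.
have ipL : ipath (s1 ++ x2 :: s2 ++ x3 :: s3).
  rewrite ipath_cat; apply/and3P; split.
  - by move: i1; rewrite -cat1s => /ipath_catr.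
  - rewrite -cat_cons ipath_cat i2 andTb; apply/andP; split.
      by move: i3; rewrite -cats1 -cat_cons => /ipath_catl.
    by rewrite allrel_consl f3 f23.
  - by rewrite allrel_catr allrel_consr f12 f13 andbT (eq_all (fun y => farC G y x3)).
have key y s z : s1 ++ x2 :: s2 ++ x3 :: s3 = y :: rcons s z ->
    adj G x1 y -> adj G x1 z -> all (far x1) s ->
    hole G (x1 :: s1 ++ x2 :: s2 ++ x3 :: s3).
  move=> e h1 h2 h3; rewrite e in ipL *; apply: hole_of_ipath => //.
  by have := girth (gcycle_of_ipath ipL h1 h2 h3); lia.
have [a1 {}i1] : adj G x1 (head x2 s1) /\ all (far x1) (behead (rcons s1 x2)).
  by case: s1 i1 {f1 f12 f13 ipL key} => [|a s]; rewrite ?ipath_cons2 ?rcons_cons;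
     rewrite ?ipath_cons2 => /and3P[].
have [a3 {}i3] : adj G x1 (last x3 s3) /\ all (far x1) (belast x3 s3).
  move: i3; rewrite -rcons_cons lastI -cats1 cat_rcons ipath_cat ipath_cons2 => /and3P[_ /andP[h _]].
  by rewrite allrel1r adj_sym (eq_all (farC G x1)) => ->.
case: s1 a1 i1 key {f1 f12 f13 ipL} => [|p s1] /= a1 i1 key;
  case/lastP: s3 a3 i3 key {f3 f23} => [|s3 q].
- move=> a3 i3 key; apply: (key x2 s2 x3) => //; by rewrite cats1.
- rewrite last_rcons belast_rcons => a3 /= /andP[f31 i3] key.
  apply: (key x2 (s2 ++ x3 :: s3) q) => //; first by rewrite rcons_cat.
  by rewrite all_cat /= f2 f31.
- move=> a3 i3 key; apply: (key p (s1 ++ x2 :: s2) x3) => //.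
    by rewrite -cats1 -catA cat_cons.
  by move: i1; rewrite all_rcons => /andP[f12 i1]; rewrite all_cat /= i1 f12.
- rewrite last_rcons belast_rcons => a3 /= /andP[f31 i3] key.
  apply: (key p (s1 ++ x2 :: s2 ++ x3 :: s3) q) => //.
    by rewrite !rcons_cat /= rcons_cat.
  move: i1; rewrite all_rcons => /andP[f12 i1].
  by rewrite all_cat /= all_cat /= i1 f12 f2 f31.
Qed.

(** The first vertex of the nonempty arc [s2] serves as the third corner. *)
Lemma hole_of_ipaths2 x1 s1 x2 s2 :
  ipath (x1 :: rcons s1 x2) -> ipath (x2 :: rcons s2 x1) ->
  allrel far s1 s2 -> s2 != [::] -> hole G (x1 :: s1 ++ x2 :: s2).
Proof.
case: s2 => // z s2; rewrite rcons_cons ipath_cons2 => i1 /and3P[a f i2].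
rewrite allrel_consr => /andP[f1 f12] _.
apply: (@hole_of_ipaths3 x1 s1 x2 [::] z s2) => //.
- by rewrite /= a.
- by rewrite (eq_all (farC G z)).
- by move: f; rewrite all_rcons => /andP[].
- by rewrite allrel0r.
Qed.

(** The ear [m], which need not be induced, closes a cycle with each of the arcs [a] and [b]. Adding
    the two girth bounds and using that the arcs have [2 * l - 1] inner vertices together gives the
    estimate. *)
Lemma ear_length_split u a v b m :
  hole G (u :: a ++ v :: b) -> size (u :: a ++ v :: b) = 2 * l + 1 ->
  m != [::] -> path (adj G) u (rcons m v) -> uniq m ->
  {in m, forall q, q \notin u :: a ++ v :: b} -> 2 * l <= 2 * size m + 1.
Proof.
move=> h sz m0 pm um mc.
have sm : 0 < size m by case: m m0 {pm um mc}.
case: h => /and3P[_ uc /= cy] _ _.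
move: cy; rewrite rcons_cat cat_path /= => /and3P[pa va pb].
have key d : path (adj G) u (rcons d v) -> uniq (u :: v :: d) ->
    {subset d <= a ++ b} -> 2 * l + 1 <= size m + size d + 2.
  move=> pd ud sd.
  have : gcycle G (u :: m ++ v :: rev d).
    apply/and3P; split; first by rewrite /= size_cat /=; lia.
      rewrite -cat1s (perm_uniq (permEl (perm_catCA _ _ _))) cat_uniq um cat1s.
      move: ud; rewrite /= !inE !mem_rev rev_uniq => ->; rewrite andbT.
      rewrite !negb_or; apply/and3P; split.
      - by apply/negP=> /mc; rewrite inE eqxx.
      - by apply/negP=> /mc; rewrite !inE mem_cat inE eqxx !orbT.
      - apply/hasPn=> w; rewrite mem_rev => /sd; rewrite mem_cat => wab.
        by apply/negP=> /mc; rewrite !inE mem_cat inE; case/orP: wab => ->; rewrite !orbT.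
    rewrite /= rcons_cat cat_path /=; move: pm; rewrite rcons_path => /andP[-> ->] /=.
    have := pd; rewrite -(rev_path _ u) last_rcons belast_rcons rev_cons.
    by rewrite (eq_path (e' := adj G)) // => x y; rewrite adj_sym.
  by move/girth; rewrite /= size_cat /= size_rev; lia.
have h1 := key a; have h2 := key (rev b).
have {}h1 : 2 * l + 1 <= size m + size a + 2.
  apply: h1; first by rewrite rcons_path pa.
    move: uc; rewrite -cat_cons -cat_rcons cat_uniq => /and3P[uc _ _].
    by move: uc; rewrite rcons_cons !cons_uniq rcons_uniq mem_rcons.
  by move=> w; rewrite mem_cat => ->.
have {}h2 : 2 * l + 1 <= size m + size (rev b) + 2.
  apply: h2.
  - move: pb; rewrite -(rev_path _ v) last_rcons belast_rcons rev_cons.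
    by rewrite (eq_path (e' := adj G)) // => x y; rewrite adj_sym.
  - move: uc; rewrite cons_uniq mem_cat inE !negb_or cat_uniq /= mem_rev rev_uniq.
    by case/and5P=> /and3P[_ uv ub] _ _ vb ->; rewrite !inE negb_or uv mem_rev ub vb.
  - by move=> w; rewrite mem_rev mem_cat => ->; rewrite orbT.
by move: sz h2; rewrite /= size_cat /= size_rev; lia.
Qed.

Lemma ear_length c u v m :
  hole G c -> size c = 2 * l + 1 -> u \in c -> v \in c -> u != v ->
  m != [::] -> path (adj G) u (rcons m v) -> uniq m ->
  {in m, forall q, q \notin c} -> 2 * l <= 2 * size m + 1.
Proof.
move=> h sz uc vc uv m0 pm um mc; have [a [b [h' e s']]] := hole_pair h uc vc uv.
by apply: (ear_length_split h') => //; [rewrite -s' | move=> q /mc; rewrite e].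
Qed.

(** Two neighbours would make [q] an ear with a single inner vertex, against [ear_length]. *)
Lemma hole_one_neighbour c q u v :
  hole G c -> size c = 2 * l + 1 -> q \notin c -> u \in c -> v \in c ->
  adj G q u -> adj G q v -> u = v.
Proof.
move=> h sz qc uc vc qu qv; apply/eqP; apply: contraT => uv.
have := @ear_length c u v [:: q] h sz uc vc uv isT; rewrite /= adj_sym qu qv => /(_ isT isT).
have h1 : {in [:: q], forall q0 : T, q0 \notin c} by move=> w; rewrite inE => /eqP->.
by move=> /(_ h1); lia.
Qed.


End Girth.

(** * Induced subdivisions of K4 *)

Section K4System.
Variables (T : finType) (G : sgraph T) (l : nat).
Hypothesis l5 : 5 <= l.
Hypothesis girth : forall c, gcycle G c -> 2 * l + 1 <= size c.
Hypothesis odd_hole_size : forall c, hole G c -> odd (size c) -> size c = 2 * l + 1.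

Local Notation far := (far G).
Local Notation ipath := (ipath G).

Implicit Types (a b c d : 'I_4) (x y z v w : T) (s : seq T).

Definition same_edge a b c d : bool :=
  (a == c) && (b == d) || (a == d) && (b == c).

(* The branch vertices are [u a], and [I a b] lists the inner vertices of the
   arris from [u a] to [u b]. *)
Variables (u : 'I_4 -> T) (I : 'I_4 -> 'I_4 -> seq T).
Hypothesis I_rev : forall a b, I b a = rev (I a b).
Hypothesis I_ipath : forall a b, a != b -> ipath (u a :: rcons (I a b) (u b)).
Hypothesis I_far_u :
  forall a b c, a != b -> c != a -> c != b -> all (far (u c)) (I a b).
Hypothesis I_far : forall a b c d, a != b -> c != d -> ~~ same_edge a b c d ->
  allrel far (I a b) (I c d).

Definition arc a b : seq T := u a :: rcons (I a b) (u b).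
Definition arcs : {set T} :=
  [set x | [exists a, exists b, (a != b) && (x \in arc a b)]].
Let H := induced G arcs.

Lemma arc_rev a b : arc b a = rev (arc a b).
Proof. by rewrite /arc rev_cons rev_rcons -I_rev. Qed.

Lemma mem_arc x a b : (x \in arc a b) = [|| x == u a, x == u b | x \in I a b].
Proof. by rewrite inE mem_rcons inE. Qed.

Lemma arcsP x : reflect (exists a b, a != b /\ x \in arc a b) (x \in arcs).
Proof.
rewrite inE; apply: (iffP existsP) => [[a /existsP[b /andP[ab xab]]]|[a [b [ab xab]]]].
  by exists a, b.
by exists a; apply/existsP; exists b; rewrite ab.
Qed.

Lemma u_neq a b : a != b -> u a != u b.
Proof.
by move=> /I_ipath /ipath_uniq; rewrite /= mem_rcons inE negb_or -andbA => /and3P[].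
Qed.

Lemma u_inj : injective u.
Proof. by move=> a b e; apply/eqP; apply: contraT => /u_neq; rewrite e eqxx. Qed.

Lemma u_notin_I a b c : a != b -> u c \notin I a b.
Proof.
move=> ab; have := ipath_uniq (I_ipath ab); rewrite /= mem_rcons inE rcons_uniq negb_or.
case/and3P=> /andP[_ ua] ub _.
have [->//|ca] := eqVneq c a; have [->//|cb] := eqVneq c b.
exact/all_far_notin/I_far_u.
Qed.

Lemma arcs_cases x : x \in arcs ->
  (exists a, x = u a) \/ exists a b, a != b /\ x \in I a b.
Proof.
case/arcsP=> a [b [ab]]; rewrite mem_arc => /or3P[/eqP->|/eqP->|xI].
- by left; exists a.
- by left; exists b.
- by right; exists a, b.
Qed.

Lemma I_same_edge a b c d x :
  a != b -> c != d -> x \in I a b -> x \in I c d -> same_edge a b c d.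
Proof.
move=> ab cd xab xcd; apply: contraT => /(I_far ab cd) h.
by have := allrel_far_disjoint h xab; rewrite xcd.
Qed.

Lemma ord4_ex a : exists b : 'I_4, a != b.
Proof. by case: (eqVneq a ord0) => [->|?]; [exists ord_max | exists ord0]. Qed.

Lemma u_arcs a : u a \in arcs.
Proof.
have [b ab] := ord4_ex a; apply/arcsP; exists a, b; by rewrite mem_arc eqxx.
Qed.

Lemma adj_same_arc x y : x \in arcs -> y \in arcs -> adj G x y ->
  exists a b, [/\ a != b, x \in arc a b & y \in arc a b].
Proof.
have key c a b y' : a != b -> y' \in I a b -> adj G (u c) y' -> u c \in arc a b.
  move=> ab yI; rewrite mem_arc => cy.
  have [->|ca] := eqVneq c a; first by rewrite eqxx.
  have [->|cb] := eqVneq c b; first by rewrite eqxx orbT.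
  by have /allP/(_ _ yI) := I_far_u ab ca cb; rewrite /far cy andbF.
move=> /arcs_cases[[a ->]|[a [b [ab xI]]]] /arcs_cases[[c ->]|[c [d [cd yI]]]] xy.
- have ac : a != c by apply: contraTneq xy => ->; rewrite adj_irr.
  by exists a, c; rewrite ac !mem_arc !eqxx orbT.
- exists c, d; split=> //; first exact: key xy.
  by rewrite mem_arc yI !orbT.
- exists a, b; split=> //; first by rewrite mem_arc xI !orbT.
  by rewrite adj_sym in xy; exact: key xy.
- have : same_edge a b c d.
    apply: contraTT xy => h; have /allrelP := I_far ab cd h => /(_ _ _ xI yI).
    by case/andP.
  case/orP=> /andP[/eqP ac /eqP bd]; subst.
    by exists c, d; rewrite !mem_arc xI yI !orbT.
  exists c, d; rewrite !mem_arc yI !orbT; split=> //.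
  by move: xI; rewrite (I_rev c d) mem_rev => ->; rewrite !orbT.
Qed.

Lemma infix_arc_adj a b x y : a != b -> infix [:: x; y] (arc a b) ->
  [/\ x \in arcs, y \in arcs & adj G x y].
Proof.
move=> ab h; have s := mem_infix h.
split; try by apply/arcsP; exists a, b; split=> //; apply: s; rewrite !inE eqxx ?orbT.
have := ipath_sorted (I_ipath ab); rewrite -/(arc a b).
by case/infixP: h => s1 [s2 ->] /cat_sorted2[_] /= /andP[].
Qed.

Lemma arcs_verts x : x \in arcs -> x \in verts G.
Proof.
case/arcsP=> a [b [ab xab]]; have [s1 [s2 e]] := mem_split xab.
case: s2 e => [|y s2] e.
  case/lastP: s1 e => [|s1 y] e.
    by have := congr1 size e; rewrite /= size_rcons.
  have [|_ _] := @infix_arc_adj a b y x ab.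
    by rewrite e cat_rcons; exact: suffix_infix.
  by rewrite adj_sym; exact: adj_verts.
have [|_ _] := @infix_arc_adj a b x y ab; last exact: adj_verts.
by rewrite e -[x :: y :: s2]/([:: x; y] ++ s2) infix_infix.
Qed.

Lemma adj_arcs x y :
  adj H x y <-> exists a b, a != b /\ infix [:: x; y] (arc a b).
Proof.
split=> [/and3P[xA yA xy]|[a [b [ab h]]]]; last first.
  by have [xA yA xy] := infix_arc_adj ab h; exact/and3P.
have [a [b [ab xab yab]]] := adj_same_arc xA yA xy.
case/orP: (ipath_adj (I_ipath ab) xab yab xy) => h; first by exists a, b.
by exists b, a; rewrite eq_sym ab arc_rev -infix_revLR.
Qed.

Lemma arc_gpath a b : a != b -> gpath H (u a) (u b) (arc a b).
Proof.
move=> ab; have ip := I_ipath ab.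
have sub x : x \in arc a b -> x \in arcs by move=> h; apply/arcsP; exists a, b.
have so : sorted (adj H) (arc a b).
  apply: (sub_in_sorted (P := [in arc a b]) (e := adj G)) => //.
  - by move=> x y xa ya xy; apply/and3P; split=> //; exact: sub.
  - exact: ipath_sorted.
rewrite /gpath /= eqxx last_rcons eqxx /=.
have /= -> := ipath_uniq ip; have /= -> := so; rewrite andbT.
rewrite -[_ && all _ _]/(all [in verts H] (arc a b)).
apply/allP=> x xa; rewrite inE sub // andbT.
exact/arcs_verts/sub.
Qed.

Lemma arcs_subdivision : is_subdivision K4 H.
Proof.
exists u, arc; split.
- by move=> a b _ _; exact: u_inj.
- by move=> a b ab; split; [exact: arc_gpath | exact: arc_rev].
- split=> [a b w ab _|a b c d z ab cd].
    rewrite mem_arc => /or3P[/eqP/u_inj->|/eqP/u_inj->|]; [by left|by right|].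
    by rewrite (negbTE (u_notin_I _ ab)).
  have iu e : u e \in [set u x | x in verts K4] by apply/imsetP; exists e.
  rewrite !mem_arc => /or3P[/eqP->|/eqP->|zab]; [by right|by right|].
  case/or3P=> [/eqP->|/eqP->|zcd]; [by right|by right|left].
  by case/orP: (I_same_edge ab cd zab zcd) => /andP[/eqP-> /eqP->]; rewrite // setUC.
- move=> z; rewrite inE; split=> [/andP[_ /arcsP h]|[/imsetP[a _ ->]|[a [b [ab zab]]]]].
  + by right.
  + by rewrite u_arcs arcs_verts // u_arcs.
  + have zA : z \in arcs by apply/arcsP; exists a, b.
    by rewrite zA arcs_verts.
- exact: adj_arcs.
Qed.

(** The neighbour of [u a] on its arris towards [u b]; the default [u b] is the correct value when
    that arris is a single edge. *)
Definition first_on a b : T := head (u b) (I a b).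

Lemma arc_first a b : exists s, arc a b = [:: u a, first_on a b & s].
Proof.
rewrite /arc /first_on; case: (I a b) => [|x s]; first by exists [::].
by exists (rcons s (u b)).
Qed.

Lemma adj_u a y : adj H (u a) y -> exists2 b, a != b & y = first_on a b.
Proof.
have key c : a != c -> y \in arc a c -> adj G (u a) y -> y = first_on a c.
  move=> ac; have := I_ipath ac; rewrite -/(arc a c); have [s ->] := arc_first a c.
  rewrite ipath_cons2 => /and3P[_ f _]; rewrite !inE => /or3P[/eqP->|/eqP->|ys] //.
    by rewrite adj_irr.
  by move/(allP f): ys => /andP[_ /negbTE->].
case/and3P=> ua yA ay; have [b [c [bc]]] := adj_same_arc ua yA ay.
rewrite {1}mem_arc (negbTE (u_notin_I a bc)) orbF => /orP[/eqP/u_inj e|/eqP/u_inj e] yI; subst.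
  by exists c => //; exact: key.
by exists b; [rewrite eq_sym | apply: key; rewrite // 1?eq_sym // arc_rev mem_rev].
Qed.

Lemma adj_first_on a b : a != b -> adj H (u a) (first_on a b).
Proof.
move=> ab; apply/adj_arcs; exists a, b; split=> //.
by have [s ->] := arc_first a b; rewrite /= !eqxx prefix0s.
Qed.

Lemma first_on_inj a b c : a != b -> a != c -> first_on a b = first_on a c -> b = c.
Proof.
move=> ab ac; rewrite /first_on.
have mI d : a != d -> first_on a d = u d \/ first_on a d \in I a d.
  by move=> _; rewrite /first_on; case: (I a d) => [|x s]; [left|right; rewrite inE eqxx].
move: (mI b ab) (mI c ac); rewrite /first_on => -[->|hb] -[->|hc] e.
- exact: u_inj.
- by move: hc; rewrite -e (negbTE (u_notin_I _ ac)).
- by move: hb; rewrite e (negbTE (u_notin_I _ ab)).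
- rewrite e in hb; case/orP: (I_same_edge ab ac hb hc) => /andP[/eqP e1 /eqP e2] //.
  by rewrite e1 eqxx in ac.
Qed.

(** The map [first_on a] is a bijection from the three other indices to the neighbours of [u a]. *)
Lemma deg3_u a : deg3 H (u a).
Proof.
rewrite /deg3 /deg.
have -> : [set y | adj H (u a) y] = [set first_on a b | b in [set~ a]].
  apply/setP=> y; rewrite inE; apply/idP/imsetP => [/adj_u[b ab ->]|[b]].
    by exists b => //; rewrite !inE eq_sym.
  by rewrite !inE eq_sym => ab ->; exact: adj_first_on.
rewrite card_in_imset; last first.
  by move=> b c; rewrite !inE ![_ == a]eq_sym; exact: first_on_inj.
by rewrite cardsC1 card_ord.
Qed.

Lemma adj_inner a b s1 v w v' s2 y :
  a != b -> arc a b = s1 ++ [:: v, w, v' & s2] -> adj H w y -> y = v \/ y = v'.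
Proof.
move=> ab e wy; have ip := I_ipath ab; rewrite -/(arc a b) in ip.
have wI : w \in I a b.
  have [X e'] : exists X, rcons (I a b) (u b) = X ++ [:: w, v' & s2].
    by case: s1 e => [|z s1] [_ ->]; [exists [::] | exists (rcons s1 v); rewrite cat_rcons].
  move: e'; rewrite (lastI v' s2) -rcons_cons -rcons_cat => /rcons_inj[-> _].
  by rewrite mem_cat inE eqxx orbT.
have yab : y \in arc a b.
  case/and3P: wy => wA yA wy; have [c [d [cd wcd ycd]]] := adj_same_arc wA yA wy.
  have : same_edge a b c d.
    move: wcd; rewrite mem_arc => /or3P[/eqP e'|/eqP e'|wcd]; last exact: I_same_edge wcd.
      by rewrite e' (negbTE (u_notin_I _ ab)) in wI.
    by rewrite e' (negbTE (u_notin_I _ ab)) in wI.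
  by case/orP=> /andP[/eqP-> /eqP->] //; rewrite arc_rev mem_rev.
have {}wy : adj G w y by case/and3P: wy.
rewrite e in yab ip; move: ip.
rewrite -[s1 ++ _]/(s1 ++ [:: v] ++ w :: [:: v' & s2]) catA ipath_cat => /and3P[ip1 ip2 _].
move: ip1 ip2; rewrite cats1 -cats1 cat_rcons ipath_cat 2!ipath_cons2 => /and3P[_ _ f1] /and3P[_ f2 _].
move: yab; rewrite mem_cat !inE => /or4P[ys1|/eqP->|/eqP e'|/orP[/eqP->|ys2]]; [|by left| |by right|].
- by move/allrelP/(_ _ _ ys1 (mem_head _ _)): f1; rewrite farC /far wy andbF.
- by rewrite e' adj_irr in wy.
- by move/(allP f2): ys2; rewrite /far wy andbF.
Qed.

Lemma deg3_I a b x : a != b -> x \in I a b -> ~~ deg3 H x.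
Proof.
move=> ab /mem_split[s1 [s2 e]].
have [s [v [v' [s' e']]]] : exists s v v' s', arc a b = s ++ [:: v, x, v' & s'].
  rewrite /arc e rcons_cat rcons_cons.
  exists (belast (u a) s1), (last (u a) s1), (head (u b) s2), (behead (rcons s2 (u b))).
  rewrite -cat_cons (lastI (u a) s1) cat_rcons; by case: s2 {e}.
have : [set y | adj H x y] \subset [set v; v'].
  by apply/subsetP=> y; rewrite !inE => /(adj_inner ab e')[->|->]; rewrite eqxx ?orbT.
move/subset_leq_card; rewrite cards2 /deg3 /deg => h; apply: contraTneq h => ->.
by case: (v != v').
Qed.

Lemma count_deg3_arc a b : a != b -> count (deg3 H) (arc a b) = 2.
Proof.
move=> ab; rewrite /arc /= -cats1 count_cat /= !deg3_u.
have /eqP -> // : count (deg3 H) (I a b) == 0.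
by rewrite eqn0Ngt -has_count; apply/hasPn=> x; exact: deg3_I.
Qed.

Lemma arc_arris a b : a != b -> arris H (u a) (u b) (arc a b).
Proof. by move=> ab; split; [exact: arc_gpath| exact: deg3_u..| exact: count_deg3_arc]. Qed.

Lemma deg3_is_u x : deg3 H x -> exists a, x = u a.
Proof.
move=> d; have : 0 < deg H x by rewrite (eqP d).
case/card_gt0P=> y; rewrite inE => /and3P[xA _ _].
case: (arcs_cases xA) => // -[a [b [ab xI]]].
by rewrite (negbTE (deg3_I ab xI)) in d.
Qed.

(** An inner vertex of an arc has only its two arc neighbours in [H], and a path without repetition
    cannot turn back. The walk is therefore forced until it meets a branch vertex, which happens
    only at [u b]. *)
Lemma follow_arc a b s1 v w s s2 :
  a != b -> arc a b = s1 ++ [:: v, w & s2] ->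
  path (adj H) w s -> uniq [:: v, w & s] ->
  all (predC (deg3 H)) (belast w s) -> deg3 H (last w s) -> s = s2.
Proof.
move=> ab; elim: s2 s1 v w s => [|w' s2 IH] s1 v w s e pw un nd dl.
  have ew : w = u b.
    by move: (congr1 (last v) e); rewrite /arc /= last_rcons last_cat /= => ->.
  by case: s pw un nd dl => // z s /= _ _ /andP[]; rewrite ew deg3_u.
case: s pw un nd dl => [|w1 s] /=.
  move=> _ _ _ /deg3_is_u[c ew].
  have [X e'] : exists X, rcons (I a b) (u b) = X ++ [:: w, w' & s2].
    by case: s1 e => [|z s1] [_ ->]; [exists [::] | exists (rcons s1 v); rewrite cat_rcons].
  move: e'; rewrite (lastI w' s2) -rcons_cons -rcons_cat => /rcons_inj[e' _].
  by have := u_notin_I c ab; rewrite e' -ew mem_cat inE eqxx orbT.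
move=> /andP[ww1 ps] un /andP[_ nd] dl.
have e1 : w1 = w'.
  case: (adj_inner ab e ww1) => // ev; move: un; by rewrite ev !inE eqxx orbT.
subst w1; congr (_ :: _); apply: (IH (rcons s1 v) w w') => //; first by rewrite cat_rcons.
by case/andP: un.
Qed.

(** The first edge out of a branch vertex selects an arc, and [follow_arc] forces the rest.
    Containing just two vertices of degree three means that none occurs before the end. *)
Lemma arrisE x y s : x != y -> arris H x y s ->
  exists a b, [/\ a != b, x = u a, y = u b & s = arc a b].
Proof.
move=> xy [/and5P[s0 /eqP hs /eqP ls us /andP[_ so]] dx dy cs].
have [a ea] := deg3_is_u dx; have [b eb] := deg3_is_u dy.
case: s s0 hs ls us so cs => // z s _ /= -> ls us so cs.
case: s ls us so cs => [|w s] /= ls; first by rewrite ls eqxx in xy.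
move=> us /andP[xw so]; rewrite dx add1n => -[cs].
rewrite ea in xw us *; have [c ac ew] := adj_u xw.
have [s2 es2] := arc_first a c; rewrite -ew in es2.
have e : s = s2.
  apply: (@follow_arc a c [::] (u a) w s s2) => //; last by rewrite ls.
  have : count (deg3 H) (rcons (belast w s) (last w s)) = 1 by rewrite -lastI.
  rewrite -cats1 count_cat /= ls dy /= => h1.
  have /eqP : count (deg3 H) (belast w s) = 0 by move: h1; rewrite addn0 addn1 => -[].
  by rewrite eqn0Ngt -has_count all_predC.
subst s2; exists a, c; split=> //.
by rewrite -ls; have := congr1 (last (u a)) es2; rewrite /arc /= last_rcons => <-.
Qed.

Definition len a b : nat := (size (I a b)).+1.

Lemma lenC a b : len a b = len b a.
Proof. by rewrite /len I_rev size_rev. Qed.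

Lemma path_len_arc a b : path_len (arc a b) = len a b.
Proof. by rewrite /path_len /= size_rcons. Qed.

Lemma join3_arc a b c : join3 (arc a b) (arc b c) (arc c a) =
  rot 1 (u a :: I a b ++ u b :: I b c ++ u c :: I c a).
Proof. by rewrite rot1_cons /join3 /arc /= !(cat_rcons, rcons_cat, rcons_cons). Qed.

Lemma size_face a b c :
  size (join3 (arc a b) (arc b c) (arc c a)) = len a b + len b c + len c a.
Proof. by rewrite join3_arc size_rot /= size_cat /= size_cat /= /len; clear; lia. Qed.

Lemma not_same_edge a b c : a != c -> ~~ same_edge a b b c.
Proof.
rewrite /same_edge => /negbTE ac; rewrite ac /= orbF.
by apply/negP=> /andP[/eqP e1 /eqP e2]; rewrite e1 e2 eqxx in ac.
Qed.

Lemma hole_face a b c : a != b -> b != c -> a != c ->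
  hole G (join3 (arc a b) (arc b c) (arc c a)).
Proof.
move=> ab bc ac; have ca : c != a by rewrite eq_sym.
rewrite join3_arc; apply: hole_rot.
apply: (hole_of_ipaths3 l5 girth); try exact: I_ipath; try apply: I_far_u => //;
  rewrite 1?eq_sym //; apply: I_far => //; first exact: not_same_edge.
- by apply: not_same_edge; rewrite eq_sym.
- rewrite /same_edge (negbTE ac) /= eqxx; exact: bc.
Qed.

Lemma face_len a b c : a != b -> b != c -> a != c ->
  2 * l + 1 <= len a b + len b c + len c a.
Proof.
move=> ab bc ac; rewrite -size_face; apply: girth; by case: (hole_face ab bc ac).
Qed.

Lemma odd_face_len a b c : a != b -> b != c -> a != c ->
  odd (len a b + len b c + len c a) -> len a b + len b c + len c a = 2 * l + 1.
Proof. move=> ab bc ac; rewrite -size_face; exact/odd_hole_size/hole_face. Qed.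

Lemma u_far a b : a != b -> 1 < len a b -> far (u a) (u b).
Proof.
move=> ab; have := I_ipath ab; rewrite /len; case: (I a b) => // x s.
by rewrite rcons_cons ipath_cons2 all_rcons => /and3P[_ /andP[]].
Qed.

(** The cycle through four arrises omits those from [a] to [c] and from [b] to [d]. As these have
    length at least two, opposite corners are nonadjacent and the cycle is a hole. *)
Lemma odd_square_len a b c d :
  a != b -> a != c -> a != d -> b != c -> b != d -> c != d ->
  1 < len a c -> 1 < len b d -> odd (len a b + len b c + len c d + len d a) ->
  len a b + len b c + len c d + len d a = 2 * l + 1.
Proof.
move=> ab ac ad bc bd cd ac1 bd1 o.
have [ba ca da] : [/\ b != a, c != a & d != a] by rewrite ![_ == a]eq_sym.
have [cb db dc] : [/\ c != b, d != b & d != c].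
  by rewrite ![_ == b]eq_sym [d == c]eq_sym.
have h : hole G (u a :: I a b ++ u b :: I b c ++ u c :: I c d ++ u d :: I d a).
  have ne e f g k : e != g \/ f != k -> e != k \/ f != g -> ~~ same_edge e f g k.
    rewrite /same_edge => h1 h2; apply/negP=> /orP[]/andP[/eqP e1 /eqP e2].
      by case: h1; rewrite ?e1 ?e2 eqxx.
    by case: h2; rewrite ?e1 ?e2 eqxx.
  apply: (hole_of_ipaths3 l5 girth); try exact: I_ipath.
  - rewrite rcons_cat -cat_cons rcons_cons ipath_cat; apply/and3P; split; try exact: I_ipath.
    rewrite -cats1 allrel_catr allrel1r /= farC u_far // !allrel_consl I_far_u //=.
    rewrite I_far //; last by apply: ne; first [by left | by right].
    rewrite (eq_all (a2 := far (u a))); last by move=> x; exact: farC.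
    by rewrite I_far_u.
  - exact: I_far_u.
  - exact: I_far_u.
  - by rewrite all_cat /= u_far // !I_far_u.
  - by apply: I_far => //; apply: ne; first [by left | by right].
  - rewrite allrel_catr allrel_consr; apply/and3P; split.
    + by apply: I_far => //; apply: ne; first [by left | by right].
    + rewrite (eq_all (a2 := far (u d))); last by move=> x; exact: farC.
      exact: I_far_u.
    + by apply: I_far => //; apply: ne; first [by left | by right].
  - rewrite allrel_catr allrel_consr; apply/and3P; split.
    + by apply: I_far => //; apply: ne; first [by left | by right].
    + rewrite (eq_all (a2 := far (u d))); last by move=> x; exact: farC.
      exact: I_far_u.
    + by apply: I_far => //; apply: ne; first [by left | by right].
have := odd_hole_size h.
have -> : size (u a :: I a b ++ u b :: I b c ++ u c :: I c d ++ u d :: I d a)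
   = len a b + len b c + len c d + len d a.
  by rewrite /= !size_cat /= !size_cat /= !size_cat /= /len; clear; lia.
exact.
Qed.

(** The vertices [u a], [u b], [u c], [u d] play the roles of [u1] to [u4]: the arris $Q_1$ of
    length one runs from [b] to [c], and the longer $L_2$ from [b] to [d]. *)
Lemma balanced_of_arcs a b c d :
  a != b -> a != c -> a != d -> b != c -> b != d -> c != d ->
  odd (len a b + len b c + len c a) -> odd (len a b + len b d + len d a) ->
  ~~ odd (len c d + len d b + len b c) -> ~~ odd (len c d + len d a + len a c) ->
  len b c = 1 -> 1 < len b d -> has_balanced_K4_subdivision_12 G.
Proof.
move=> ab ac ad bc bd cd o1 o2 o3 o4 q1 l2.
exists arcs; split; first exact: arcs_subdivision.
exists (u a), (u b), (u c), (u d), (arc a b), (arc c d), (arc b c), (arc a d), (arc a c), (arc b d).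
rewrite -!arc_rev; split.
- by rewrite /= !inE !negb_or !u_neq.
- by split; [exact: arc_arris..|split; exact: arc_arris].
- by split; split; rewrite ?size_face //; apply: hole_face; rewrite // eq_sym.
- by split; split; rewrite ?size_face //; apply: hole_face; rewrite // eq_sym.
- by rewrite !path_len_arc.
Qed.

(** By [arrisE] an abstract face cycle consists of three arcs, whose common ends are matched by
    injectivity of [u]. *)
Lemma odd_K4_of_arcs :
  (forall a b c, a != b -> b != c -> a != c -> odd (len a b + len b c + len c a)) ->
  has_odd_K4_subdivision G.
Proof.
move=> o; exists H; split.
- split; first exact: subsetIl.
  by move=> x y /and3P[].
- exact: arcs_subdivision.
move=> _ [x [y [z [s1 [s2 [s3 [un r1 r2 r3 ->]]]]]]].
move: un; rewrite /= !inE negb_or => /and3P[/andP[xy xz] yz _].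
have [a [b [ab ex ey ->]]] := arrisE xy r1.
have [b' [c [bc ey' ez ->]]] := arrisE yz r2.
rewrite eq_sym in xz; have [c' [a' [ca ez' ex' ->]]] := arrisE xz r3.
have eb : b' = b by apply: u_inj; rewrite -ey' -ey.
have ec : c' = c by apply: u_inj; rewrite -ez' -ez.
have ea : a' = a by apply: u_inj; rewrite -ex' -ex.
subst b' c' a'; have ac : a != c by rewrite eq_sym.
by split; [exact: hole_face | rewrite size_face o].
Qed.

(* If all four arrises other than [ab] and [cd] had length at least 2, both odd
   4-cycles through [ab] and [cd] would be holes of length [2 * l + 1], which
   together with the two odd faces forces [len c d = 0]. *)
Lemma two_odd_faces a b c d :
  a != b -> a != c -> a != d -> b != c -> b != d -> c != d ->
  odd (len a b + len b c + len c a) -> odd (len a b + len b d + len d a) ->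
  ~~ odd (len c d + len d b + len b c) ->
  [\/ has_balanced_K4_subdivision_12 G, len b c = 1 /\ len b d = 1 |
      len a c = 1 /\ len a d = 1].
Proof.
move=> ab ac ad bc bd cd o1 o2 o3.
have [ba ca da] : [/\ b != a, c != a & d != a] by rewrite ![_ == a]eq_sym.
have [cb db dc] : [/\ c != b, d != b & d != c].
  by rewrite ![_ == b]eq_sym [d == c]eq_sym.
have e1 := odd_face_len ab bc ac o1; have e2 := odd_face_len ab bd ad o2.
have Lba := lenC a b; have Lca := lenC a c; have Lda := lenC a d.
have Lcb := lenC b c; have Ldb := lenC b d; have Ldc := lenC c d.
(* Each arris lies on two faces, so the four face lengths have an even sum and the fourth face is
   even as well. *)
have o4 : ~~ odd (len c d + len d a + len a c).
  by clear -o1 o2 o3 Lba Lca Lda Lcb Ldb Ldc; lia.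
(* The labelling can start at either end of [ab] and take [c] and [d] in either order. The four
   instances apply when exactly one arris at [b], or exactly one at [a], among those to [c] and [d]
   has length one. *)
have := @balanced_of_arcs a b c d ab ac ad bc bd cd o1 o2 o3 o4.
have := @balanced_of_arcs a b d c ab ad ac bd bc dc o2 o1.
have := @balanced_of_arcs b a c d ba bc bd ac ad cd.
have := @balanced_of_arcs b a d c ba bd bc ad ac dc.
have := @odd_square_len a b c d ab ac ad bc bd cd.
have := @odd_square_len a b d c ab ad ac bd bc dc.
have l0 e f : 0 < len e f by [].
have p1 := l0 a b; have p2 := l0 c d; have p3 := l0 b c; have p4 := l0 b d.
have p5 := l0 a c; have p6 := l0 a d.
rewrite -Lba -Lca -Lda -Lcb -Ldb -Ldc in o1 o2 o3 o4 e1 e2 *.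
move: o1 o2 o3 o4 e1 e2 p1 p2 p3 p4 p5 p6.
move: (len a b) (len a c) (len a d) (len b c) (len b d) (len c d).
clear; move=> ab ac ad bc bd cd o1 o2 o3 o4 e1 e2 p1 p2 p3 p4 p5 p6 s2 s1 B4 B3 B2 B1.
have [bc1|bc2] := eqVneq bc 1; have [bd1|bd2] := eqVneq bd 1.
- by constructor 2.
- by constructor 1; apply: B1 => //; clear -p4 bd2; lia.
- by constructor 1; apply: B2 => //; clear -p3 bc2 o3 o4; lia.
have [ac1|ac2] := eqVneq ac 1; have [ad1|ad2] := eqVneq ad 1.
- by constructor 3.
- by constructor 1; apply: B3 => //; clear -p6 ad2 o1 o2 o3 o4; lia.
- by constructor 1; apply: B4 => //; clear -p5 ac2 o1 o2 o3 o4; lia.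
exfalso; clear B1 B2 B3 B4.
have {}s1 : ab + bc + cd + ad = 2 * l + 1.
  by apply: s1; clear -p5 ac2 p4 bd2 o1 o2 o3 o4; lia.
have {}s2 : ab + bd + cd + ac = 2 * l + 1.
  by apply: s2; clear -p6 ad2 p3 bc2 o1 o2 o3 o4; lia.
clear -s1 s2 e1 e2 p2; lia.
Qed.

Let i0 : 'I_4 := @Ordinal 4 0 isT.
Let i1 : 'I_4 := @Ordinal 4 1 isT.
Let i2 : 'I_4 := @Ordinal 4 2 isT.
Let i3 : 'I_4 := @Ordinal 4 3 isT.

(** The number of odd faces is even, so either all are odd or exactly one face besides 012 is. In
    the second case [two_odd_faces] is applied to the arris shared by the odd faces. A pair of unit
    arrises containing 30 or 31 contradicts the lower bounds; the pairs 21, 23 and 20, 23 lie on an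
    even face, where girth and parity give 31 or 30 length at least [2 * l]. *)
Lemma K4_of_arcs :
  odd (len i0 i1 + len i1 i2 + len i2 i0) ->
  1 < len i3 i0 < 2 * l -> 1 < len i3 i1 < 2 * l ->
  has_odd_K4_subdivision G \/ has_balanced_K4_subdivision_12 G.
Proof.
move=> o /andP[l0 l0'] /andP[l1 l1'].
have c01 := lenC i0 i1; have c02 := lenC i0 i2; have c03 := lenC i0 i3.
have c12 := lenC i1 i2; have c13 := lenC i1 i3; have c23 := lenC i2 i3.
have E a : [\/ a = i0, a = i1, a = i2 | a = i3].
  by case: a => [[|[|[|[|//]]]] ?]; [constructor 1|constructor 2|constructor 3|constructor 4];
     exact: val_inj.
have A1 : (forall a b c, a != b -> b != c -> a != c -> odd (len a b + len b c + len c a)) ->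
  has_odd_K4_subdivision G := odd_K4_of_arcs.
have T1 := @two_odd_faces i0 i1 i2 i3 isT isT isT isT isT isT.
have T2 := @two_odd_faces i0 i2 i1 i3 isT isT isT isT isT isT.
have T3 := @two_odd_faces i1 i2 i0 i3 isT isT isT isT isT isT.
have F1 := @face_len i2 i1 i3 isT isT isT.
have F2 := @face_len i2 i0 i3 isT isT isT.
rewrite -c01 -c02 -c03 -c12 -c13 -c23 in o l0 l0' l1 l1' T1 T2 T3 F1 F2.
have [o1|e1] := boolP (odd (len i0 i1 + len i1 i3 + len i0 i3));
have [o2|e2] := boolP (odd (len i0 i2 + len i2 i3 + len i0 i3)).
- left; apply: A1 => a b c ab bc ac.
  move: ab bc ac; case: (E a) => ->; case: (E b) => ->; case: (E c) => -> // _ _ _;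
    rewrite -?c01 -?c02 -?c03 -?c12 -?c13 -?c23; clear -o o1 o2; lia.
- have [|||B|[h1 h2]|[h1 h2]] := T1; first by clear -o o1 e2; lia.
  + by clear -o o1 e2; lia.
  + by clear -o o1 e2; lia.
  + by right.
  + by rewrite h2 in l1.
  + by rewrite h2 in l0.
- have [|||B|[h1 h2]|[h1 h2]] := T2; first by clear -o o2 e1; lia.
  + by clear -o o2 e1; lia.
  + by clear -o o2 e1; lia.
  + by right.
  + by exfalso; clear -F1 h1 h2 l1' o o2 e1; lia.
  + by rewrite h2 in l0.
- have [|||B|[h1 h2]|[h1 h2]] := T3; first by clear -o e1 e2; lia.
  + by clear -o e1 e2; lia.
  + by clear -o e1 e2; lia.
  + by right.
  + by exfalso; clear -F2 h1 h2 l0' o e1 e2; lia.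
  + by rewrite h2 in l1.
Qed.

End K4System.

(** * A subdivision of K4 from a theta with a connecting path *)

Section Claw.
Variables (T : finType) (G : sgraph T) (l : nat).
Hypothesis l5 : 5 <= l.
Hypothesis girth : forall c, gcycle G c -> 2 * l + 1 <= size c.
Hypothesis odd_hole_size : forall c, hole G c -> odd (size c) -> size c = 2 * l + 1.
Implicit Types (x y z u v w q p t : T) (s c a b m d r : seq T).

Local Notation far := (far G).
Local Notation ipath := (ipath G).

(** Only pairs with [i < j] are tabulated, and reversal supplies the others, as [I_rev] demands. The
    default value is reached only on the diagonal. *)
Definition K4_inner s01 s02 s12 s03 s13 s23 (i j : 'I_4) : seq T :=
  let f (i j : nat) := match i, j with
    | 0, 1 => s01 | 0, 2 => s02 | 1, 2 => s12
    | 0, 3 => s03 | 1, 3 => s13 | 2, 3 => s23 | _, _ => [::] end in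
  if i < j then f i j else rev (f j i).

Lemma ipath_flip x s y : ipath (x :: rcons s y) -> ipath (y :: rcons (rev s) x).
Proof. by rewrite -ipath_rev rev_cons rev_rcons. Qed.

(** The form of [K4_of_arcs] for explicit lists: [far] being symmetric, each pair of pieces is
    compared once, and the bounds are shifted by one because they count inner vertices. *)
Lemma K4_of_pieces x0 x1 x2 x3 s01 s02 s12 s03 s13 s23 :
  ipath (x0 :: rcons s01 x1) -> ipath (x0 :: rcons s02 x2) ->
  ipath (x1 :: rcons s12 x2) -> ipath (x0 :: rcons s03 x3) ->
  ipath (x1 :: rcons s13 x3) -> ipath (x2 :: rcons s23 x3) ->
  allrel far s01 (x2 :: x3 :: s02 ++ s12 ++ s03 ++ s13 ++ s23) ->
  allrel far s02 (x1 :: x3 :: s12 ++ s03 ++ s13 ++ s23) ->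
  allrel far s12 (x0 :: x3 :: s03 ++ s13 ++ s23) ->
  allrel far s03 (x1 :: x2 :: s13 ++ s23) ->
  allrel far s13 (x0 :: x2 :: s23) ->
  allrel far s23 [:: x0; x1] ->
  odd (size s01 + size s12 + size s02 + 3) ->
  0 < size s03 < 2 * l - 1 -> 0 < size s13 < 2 * l - 1 ->
  has_odd_K4_subdivision G \/ has_balanced_K4_subdivision_12 G.
Proof.
move=> p01 p02 p12 p03 p13 p23; rewrite !(allrel_consr, allrel_catr) allrel0r andbT.
have fE x s : all (far^~ x) s = all (far x) s by apply: eq_all => y; exact: farC.
rewrite !fE => /and5P[f012 f013 g1 g2 /and3P[g3 g4 g5]] /and5P[f021 f023 g6 g7 /andP[g8 g9]].
move=> /and5P[f120 f123 g10 g11 g12] /and4P[f031 f032 g13 g14] /and3P[f130 f132 g15].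
move=> /andP[f230 f231] o h0 h1.
pose I := K4_inner s01 s02 s12 s03 s13 s23.
pose U (i : 'I_4) := nth x0 [:: x0; x1; x2; x3] i.
apply: (@K4_of_arcs T G l l5 girth odd_hole_size U I).
- by case=> [[|[|[|[|//]]]] ?] [[|[|[|[|//]]]] ?]; rewrite /I /K4_inner /= ?revK.
- by case=> [[|[|[|[|//]]]] ?] [[|[|[|[|//]]]] ?]; rewrite /I /K4_inner //= => _; exact: ipath_flip.
- by case=> [[|[|[|[|//]]]] ?] [[|[|[|[|//]]]] ?] [[|[|[|[|//]]]] ?];
     rewrite /I /K4_inner //= ?all_rev.
- by case=> [[|[|[|[|//]]]] ?] [[|[|[|[|//]]]] ?] [[|[|[|[|//]]]] ?] [[|[|[|[|//]]]] ?];
     rewrite /I /K4_inner //= ?allrel_revl ?allrel_revr // allrel_farC.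
- change (is_true (odd ((size s01).+1 + (size s12).+1 + (size (rev s02)).+1))).
  by rewrite size_rev; clear -o; lia.
- change (is_true (1 < (size (rev s03)).+1 < 2 * l)).
  by rewrite size_rev; clear -h0; lia.
- change (is_true (1 < (size (rev s13)).+1 < 2 * l)).
  by rewrite size_rev; clear -h1; lia.
Qed.

(** The branch vertices are [s], [t], [z], [c]. The odd hole is the face opposite [c], and [r1],
    [r2] are the insides of the arrises from [c] to [s] and [t]; that both are nonempty and [r] is
    not too long puts their lengths strictly between [1] and [2 * l]. *)
Lemma theta_claw (s : T) a1 z a2 t b r1 (c : T) r2 m :
  hole G (s :: (a1 ++ z :: a2) ++ t :: b) ->
  odd (size (s :: (a1 ++ z :: a2) ++ t :: b)) -> b != [::] ->
  ipath (s :: rcons (r1 ++ c :: r2) t) ->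
  allrel far (r1 ++ c :: r2) ((a1 ++ z :: a2) ++ b) ->
  ipath (c :: rcons m z) ->
  allrel far m (s :: t :: a1 ++ a2 ++ b ++ r1 ++ r2) ->
  r1 != [::] -> r2 != [::] -> size (r1 ++ c :: r2) <= 2 * l - 2 ->
  has_odd_K4_subdivision G \/ has_balanced_K4_subdivision_12 G.
Proof.
move=> h o b0 ipr fr ipm fm r10 r20 szr.
have [ipa ipb fab] : [/\ ipath (s :: rcons (a1 ++ z :: a2) t),
   ipath (t :: rcons b s) & allrel far (a1 ++ z :: a2) b].
  by apply: hole_split h _ b0; case: (a1).
move: ipa; rewrite rcons_cat rcons_cons -cat_cons ipath_cat => /and3P[ia1 ia2 fa].
move: ipr; rewrite rcons_cat rcons_cons -cat_cons ipath_cat => /and3P[ir1 ir2 frr].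
have fE x s' : all (far^~ x) s' = all (far x) s' by apply: eq_all => y; exact: farC.
move: fa frr; rewrite !allrel_consl -!cats1 !allrel_catr !allrel1r !all_cat /= !andbT !fE.
move=> /and3P[/andP[fsa2 fst] fa12 fta1] /and3P[/andP[fsr2 _] fr12 ftr1].
move: fr; rewrite allrel_catr => /andP[].
rewrite !allrel_catl !allrel_consl !allrel_catr !allrel_consr all_cat /= !fE.
move=> /and3P[/and3P[fr1a1 fzr1 fr1a2] /and3P[fca1 fcz fca2] /and3P[fr2a1 fzr2 fr2a2]].
move=> /and3P[fr1b fcb fr2b].
move: fab; rewrite allrel_catl allrel_consl => /and3P[fa1b fzb fa2b].
move: fm; rewrite !(allrel_catr, allrel_consr) !fE.
move=> /and5P[fsm ftm fma1 fma2 /and3P[fmb fmr1 fmr2]].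
apply: (@K4_of_pieces s t z c (rev b) a1 (rev a2) r1 (rev r2) (rev m)).
1-6: first [exact: ipath_flip | by []].
1-6: rewrite ?allrel_revl !(allrel_consr, allrel_catr, allrel_revr) ?allrel0r ?all_rev !fE ?andbT.
- rewrite fzb fcb allrel_farC fa1b allrel_farC fa2b allrel_farC fr1b allrel_farC fr2b.
  by rewrite allrel_farC fmb.
- rewrite fta1 fca1 fa12 allrel_farC fr1a1 allrel_farC fr2a1; by rewrite allrel_farC fma1.
- rewrite fsa2 fca2 allrel_farC fr1a2 allrel_farC fr2a2; by rewrite allrel_farC fma2.
- by rewrite ftr1 fzr1 fr12 allrel_farC fmr1.
- by rewrite fsr2 fzr2 allrel_farC fmr2.
- by rewrite fsm ftm.
- by move: o; rewrite /= !size_cat /= !size_rev; clear; lia.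
- move: r10 szr; rewrite -size_eq0 -lt0n size_cat [size (c :: _)]/= => -> /=; clear -l5 => h; lia.
- rewrite size_rev; move: r20 szr; rewrite -size_eq0 -lt0n size_cat [size (c :: _)]/= => -> /=.
  clear -l5 => h; lia.
Qed.

End Claw.

(** * Paths leaving a subgraph *)

Section Link.
Variables (T : finType) (G : sgraph T).
Implicit Types (x y z u v w q p t c d : T) (s a b m r X : seq T).

Local Notation far := (far G).
Local Notation ipath := (ipath G).

(** [path_between] is applied to the properties of having a neighbour in [A] and of having one in
    [B]. Then only the first vertex sees [A] and only the last sees [B], and uniqueness of
    neighbours leaves [c] and [d]. The set [E] collects further attachments that are tolerated. *)
Lemma link X (A B E : pred T) p s :
  path (adj G) p s -> {in p :: s, forall q, q \notin X} ->
  (exists c, [/\ c \in X, A c & adj G p c]) ->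
  (exists d, [/\ d \in X, B d & adj G (last p s) d]) ->
  (forall q v, q \in p :: s -> v \in X -> adj G q v -> [|| A v, B v | E v]) ->
  (forall q u v, q \in p :: s -> u \in X -> v \in X -> A u && A v || B u && B v ->
     adj G q u -> adj G q v -> u = v) ->
  (forall c d, c \in X -> d \in X -> A c -> B d -> far c d) ->
  exists c d m, [/\ c \in X, d \in X, A c & B d] /\
    [/\ m != [::], ipath (c :: rcons m d), {subset m <= p :: s} &
        forall q v, q \in m -> v \in X -> adj G q v -> [|| v == c, v == d | E v]].
Proof.
move=> ps sX [c0 [c0X Ac0 pc0]] [d0 [d0X Bd0 pd0]] nb un ff.
pose A' q := has (fun v => A v && adj G q v) X.
pose B' q := has (fun v => B v && adj G q v) X.
have [|||y [r [ip /allP sub [/hasP[c cX /andP[Ac yc]] /hasP[d dX /andP[Bd rd]]] nA oB]]] :=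
  @path_between T G A' B' (mem (p :: s)) p s ps.
- exact/allP.
- by apply/hasP; exists c0; rewrite // Ac0.
- by apply/hasP; exists d0; rewrite // Bd0.
exists c, d, (y :: r); split=> //; split=> //.
- rewrite rcons_cons ipath_cons2 adj_sym yc all_rcons ff //=.
  apply/andP; split.
    apply/allP=> q qr; have qX : q \notin X by apply/sX/sub; rewrite inE qr orbT.
    rewrite /far; apply/andP; split; first by apply: contraNneq qX => <-.
    apply: contra (nA _ qr) => cq; apply/hasP; exists c => //; by rewrite Ac adj_sym.
  rewrite -/(ipath (y :: rcons r d)) -rcons_cons (lastI y r) -cats1 cat_rcons ipath_cat.
  rewrite -lastI ip ipath_cons2 rd /= allrel1r; apply/allP=> q qb.
  have qr : q \in y :: r by exact: mem_belast.
  have qX : q \notin X by exact/sX/sub.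
  rewrite /far; apply/andP; split; first by apply: contraNneq qX => ->.
  apply/negP=> qd; have eq : q = last y r.
    by apply: oB => //; apply/hasP; exists d; rewrite // Bd.
  by have := ipath_uniq ip; rewrite lastI rcons_uniq -eq qb.
- move=> q v qm vX qv; have qs := sub _ qm.
  case/or3P: (nb _ _ qs vX qv) => [Av|Bv|->]; last by rewrite !orbT.
    have qy : q = y.
      move: qm; rewrite inE => /orP[/eqP//|/nA/negP[]].
      by apply/hasP; exists v; rewrite // Av.
    subst q; by rewrite (un y v c qs vX cX) ?eqxx // Av Ac.
  have qy : q = last y r by apply: oB => //; apply/hasP; exists v; rewrite // Bv.
  by rewrite (un q v d qs vX dX) ?eqxx ?orbT // ?Bv ?Bd ?orbT // qy.
Qed.

End Link.

Section Escape.
Variables (T : finType) (G : sgraph T).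
Implicit Types (x y z u v w q p t c d : T) (s a b m r X : seq T).
Hypothesis no_P3_cut : ~ has_P3_cut G.
Hypothesis no_deg2 : ~ exists v, v \in verts G /\ deg G v = 2.

Lemma third_neighbour y1 y y2 : adj G y y1 -> adj G y y2 -> y1 != y2 ->
  exists v, [/\ adj G y v, v != y1 & v != y2].
Proof.
move=> a1 a2 n12; have [/existsP[v /and3P[]]|] :=
  boolP [exists v, [&& adj G y v, v != y1 & v != y2]]; first by exists v.
rewrite negb_exists => /forallP h; case: no_deg2; exists y; split.
  exact: adj_verts a1.
rewrite /deg -(_ : [set y1; y2] = [set v | adj G y v]) ?cards2 ?n12 //.
apply/setP=> v; rewrite !inE; apply/orP/idP => [[/eqP->|/eqP->]//|yv].
have := h v; rewrite yv /= negb_and !negbK => /orP[]; [by left|by right].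
Qed.

(** Since [y1], [y], [y2] is not a $P_3$-cut, deleting it leaves a walk from [v] to [w]; it is
    stopped just before it first enters [X]. *)
Lemma escape y1 y y2 X v w :
  adj G y y1 -> adj G y y2 -> y1 != y2 ->
  v \in verts G -> v \notin X -> v \notin [:: y1; y; y2] ->
  w \in verts G -> w \in X -> w \notin [:: y1; y; y2] ->
  exists r z, [/\ path (adj G) v r, {in v :: r, forall q, q \notin X},
                 z \in X, z \notin [:: y1; y; y2] & adj G (last v r) z].
Proof.
move=> a1 a2 n12 vG vX vN wG wX wN.
have : connect (adj (del_verts G [set x in [:: y1; y; y2]])) v w.
  apply: contraT => nc; case: no_P3_cut; exists y1, y2, [:: y1; y; y2]; split=> //.
    rewrite /gpath /= !eqxx /= !inE negb_or n12 eq_sym (adj_neq a1) (adj_neq a2) /=.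
    rewrite [adj _ y1 _]adj_sym a1 a2 !andbT.
    rewrite (adj_verts a1) [_ \in _](@adj_verts _ G y1 y) ?[y2 \in _](@adj_verts _ G y2 y) //;
    by rewrite adj_sym.
  by exists v, w; split=> //; rewrite /= in_setI ?vG ?wG in_setC in_set.
case/connectP=> p; elim: p v vX vN {vG} => [|u p IH] v vX vN /=.
  by move=> _ e; rewrite -e wX in vX.
case/andP=> /and3P[_ uN vu] pu ew.
have {}uN : u \notin [:: y1; y; y2] by move: uN; rewrite !inE.
have [uX|uX] := boolP (u \in X).
  exists [::], u; split=> // q; by rewrite inE => /eqP->.
have [r [z [h1 h2 h3 h4 h5]]] := IH u uX uN pu ew.
exists (u :: r), z; split=> //=; first by rewrite vu.
by move=> q; rewrite inE => /orP[/eqP->//|/h2].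
Qed.

End Escape.

(** * Thetas over an odd hole *)

Section Theta.
Variables (T : finType) (G : sgraph T) (l : nat).
Hypothesis l5 : 5 <= l.
Hypothesis girth : forall c, gcycle G c -> 2 * l + 1 <= size c.
Hypothesis odd_hole_size : forall c, hole G c -> odd (size c) -> size c = 2 * l + 1.
Implicit Types (s t x y z u v w q p c d : T) (a b m r X : seq T).

Local Notation far := (far G).
Local Notation ipath := (ipath G).

(** The odd hole has arcs [a] and [b] between [s] and [t], and [r] lists the inner vertices of the
    third path. Both arcs being nonempty makes [s] and [t] nonadjacent. *)
Definition theta s a t b r : Prop :=
  [/\ hole G (s :: a ++ t :: b), odd (size (s :: a ++ t :: b)), a != [::] & b != [::]] /\
  [/\ r != [::], ipath (s :: rcons r t) & allrel far r (a ++ b)].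

Lemma rev_neq0 a : (rev a != [::]) = (a != [::]).
Proof. by rewrite -!size_eq0 size_rev. Qed.

Lemma theta_swap s a t b r : theta s a t b r -> theta s (rev b) t (rev a) r.
Proof.
case=> -[h o a0 b0] [r0 ip f]; split; split=> //; rewrite ?rev_neq0 //.
- exact: hole_flip.
- by move: o; rewrite /= !size_cat /= !size_rev !addnS [size b + _]addnC.
- by rewrite allrel_catr !allrel_revr andbC -allrel_catr.
Qed.

Lemma theta_rev s a t b r : theta s a t b r -> theta t (rev a) s (rev b) (rev r).
Proof.
case=> -[h o a0 b0] [r0 ip f]; split; split=> //; rewrite ?rev_neq0 //.
- by apply: hole_flip; exact: (@hole_rotC T G (s :: a) (t :: b)).
- by move: o; rewrite /= !size_cat /= !size_rev.
- exact: ipath_flip.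
- by rewrite allrel_catr !allrel_revr !allrel_revl -allrel_catr.
Qed.

Lemma theta_size s a t b r : theta s a t b r -> size a + size b + 2 = 2 * l + 1.
Proof.
case=> -[h o _ _] _; rewrite -(odd_hole_size h o) /= size_cat /=; clear; lia.
Qed.

Lemma theta_hole s a t b r : theta s a t b r -> hole G (s :: r ++ t :: rev a).
Proof.
case=> -[h o a0 b0] [r0 ip f].
have [ipa ipb fab] := hole_split h a0 b0.
apply: (hole_of_ipaths2 l5 girth) => //; first exact: ipath_flip.
  by move: f; rewrite allrel_catr allrel_revr => /andP[].
by rewrite rev_neq0.
Qed.

(** As [size a + size b] is odd, exactly one of the two cycles through [r] is odd. Being a hole it
    has length [2 * l + 1], so [r] is as long as the arc it does not use, and the girth bound for
    the other cycle makes that arc the longer one. *)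
Lemma theta_length s a t b r : theta s a t b r ->
  size r = size b /\ l <= size b \/ size r = size a /\ l <= size a.
Proof.
move=> th; have sz := theta_size th.
have h1 := theta_hole th; have h2 := theta_hole (theta_swap th).
have g1 : 2 * l + 1 <= size (s :: r ++ t :: rev a) by apply: girth; case: h1.
have g2 : 2 * l + 1 <= size (s :: r ++ t :: rev (rev b)) by apply: girth; case: h2.
have o1 := odd_hole_size h1; have o2 := odd_hole_size h2.
move: g1 g2 o1 o2; rewrite revK /= !size_cat /= size_rev; move: sz.
move: (size a) (size b) (size r); clear -l5 => na nb nr sz g1 g2 o1 o2.
have [o|e] := boolP (odd (nr + na)).
  left; have : (nr + na.+1).+1 = 2 * l + 1 by apply: o1; clear -o; lia.
  clear -sz g2; lia.
right; have : (nr + nb.+1).+1 = 2 * l + 1 by apply: o2; clear -e sz; lia.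
clear -sz g1; lia.
Qed.

(** This treats uniformly the cases where [c] is the end [s] or [z] is the end [t], in which [al1]
    or [ga1] is empty. *)
Lemma split_ends s r t al c be z ga :
  s :: rcons r t = al ++ c :: be ++ z :: ga ->
  exists al1 ga1, [/\ rcons al c = s :: al1, z :: ga = rcons ga1 t & r = al1 ++ be ++ ga1].
Proof.
move=> e.
have [al1 e1] : exists al1, rcons al c = s :: al1.
  by case: al e => [|x al] [-> _]; [exists [::] | exists (rcons al c)].
have [ga1 e2] : exists ga1, z :: ga = rcons ga1 t.
  exists (belast z ga); rewrite {1}lastI; congr rcons.
  have := congr1 (last s) e; rewrite /= last_rcons => ->.
  by rewrite -cat_rcons last_cat last_cat.
exists al1, ga1; split=> //; move: e; rewrite -cat_rcons e1 e2 cat_cons => -[].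
by rewrite -!rcons_cat => /rcons_inj[].
Qed.

(** The stretch [be] is replaced by [m]. Edges between [m] and [be] are harmless because [be]
    disappears. *)
Lemma theta_detour s a t b r al c be z ga m :
  theta s a t b r -> s :: rcons r t = al ++ c :: be ++ z :: ga ->
  m != [::] -> ipath (c :: rcons m z) -> allrel far m (al ++ ga ++ a ++ b) ->
  exists r', theta s a t b r' /\ size r' + size be = size r + size m.
Proof.
case=> hh [r0 ip f] e m0 ipm fm.
have [al1 [ga1 [e1 e2 e3]]] := split_ends e.
have e' : s :: rcons (al1 ++ m ++ ga1) t = al ++ c :: m ++ z :: ga.
  by rewrite -cat_rcons e1 e2 cat_cons -!rcons_cat.
exists (al1 ++ m ++ ga1); split; last by rewrite e3 !size_cat; clear; lia.
split=> //; split.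
- by case: (m) m0 => // x m' _; case: (al1).
- rewrite e'; move: ip; rewrite e => ip.
  move: fm; rewrite !allrel_catr => /and3P[fmal fmga fmab].
  move: ip; rewrite -cat_cons catA ipath_cat => /and3P[ip1 ip2 ip3].
  move: ip1 ip3; rewrite rcons_cat rcons_cons ipath_cat allrel_catl allrel_consl.
  move=> /and3P[ip11 ip12 ip13] /and3P[f1 f2 f3].
  rewrite -cat_cons catA ipath_cat ip2 rcons_cat rcons_cons ipath_cat ip11 ipm.
  rewrite allrel_catl allrel_consl f1 f2 fmga !andbT /= -cats1 allrel_catr.
  rewrite allrel_farC fmal.
  by move: ip13; rewrite -cats1 allrel_catr => /andP[].
- move: f; rewrite e3 !allrel_catl => /and3P[-> _ ->]; rewrite andbT /=.
  by move: fm; rewrite !allrel_catr => /and4P[_ _ -> ->].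
Qed.

(** By [theta_length] the rerouted path is again as long as [b], hence [m] is as long as [be]. The
    path [r] and the arc [a] form an odd hole, over which [m] is a jump; it is shorter than [r]
    because [be] is not all of [r]. *)
Lemma theta_detour_smaller s a t b r al c be z ga m :
  theta s a t b r -> size r = size b -> size a < l ->
  s :: rcons r t = al ++ c :: be ++ z :: ga -> (al != [::]) || (ga != [::]) ->
  m != [::] -> ipath (c :: rcons m z) ->
  allrel far m (al ++ be ++ ga ++ a ++ b) ->
  exists s' a' t' b' r', theta s' a' t' b' r' /\ size r' < size r.
Proof.
move=> th rb al_ e ne m0 ipm fm.
have fm' : allrel far m (al ++ ga ++ a ++ b).
  by move: fm; rewrite !allrel_catr => /and5P[-> _ -> -> ->].
have [r' [th' szr']] := theta_detour th e m0 ipm fm'.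
have szm : size m = size be.
  by case: (theta_length th') => -[h1 h2]; clear -szr' rb al_ h1 h2; lia.
have [al1 [ga1 [e1 e2 e3]]] := split_ends e.
exists c, be, z, (ga ++ rev a ++ al), m; split; last first.
  rewrite szm e3 !size_cat.
  have s1 : size al1 = size al.
    by have := congr1 size e1; rewrite size_rcons /= => -[].
  have s2 : size ga1 = size ga.
    by have := congr1 size e2; rewrite size_rcons /= => -[].
  have pos : 0 < size al + size ga by move: ne; case: (al); case: (ga).
  by rewrite s1 s2; clear -pos; lia.
have D := theta_hole th.
have eD : s :: r ++ t :: rev a = al ++ c :: be ++ z :: ga ++ rev a.
  by rewrite -cat_rcons -cat_cons e -catA /= -catA.
have szD : odd (size (s :: r ++ t :: rev a)).
  rewrite /= size_cat /= size_rev rb; have := theta_size th; clear; lia.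
case: (th) => -[_ _ a0 _] _.
split; split=> //.
- by rewrite eD in D; have := hole_rotC D; rewrite /= -catA /= -catA.
- rewrite eD in szD; move: szD; rewrite /= !(size_cat, size_rev) /= !(size_cat, size_rev) /=.
  rewrite !(size_cat, size_rev); clear; lia.
- by rewrite -size_eq0 -szm size_eq0.
- by case: (a) a0 => // x a1 _; rewrite -size_eq0 !size_cat rev_cons size_rcons; clear; lia.
- by move: fm; rewrite !allrel_catr allrel_revr => /and5P[-> -> -> -> _].
Qed.

Lemma theta_ear s a t b r c z m :
  theta s a t b r -> size r = size b -> c \in r -> z \in r -> c != z ->
  m != [::] -> ipath (c :: rcons m z) ->
  {in m, forall q, q \notin s :: rcons r t ++ a} -> 2 * l <= 2 * size m + 1.
Proof.
move=> th rb cr zr cz m0 ipm mX.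
apply: (@ear_length T G l l5 girth (s :: r ++ t :: rev a) c z m) => //.
- exact: theta_hole th.
- by rewrite /= size_cat /= size_rev; have := theta_size th; rewrite rb; clear; lia.
- by rewrite inE mem_cat cr orbT.
- by rewrite inE mem_cat zr orbT.
- exact: (ipath_sorted ipm).
- by have := ipath_uniq ipm; rewrite /= rcons_uniq => /and3P[].
- by move=> q /mX; rewrite !(inE, mem_cat, mem_rcons, mem_rev) !negb_or -!andbA => /and4P[-> -> -> ->].
Qed.

End Theta.

(** * Attachments to a theta *)

Section ThetaAttachments.
Variables (T : finType) (G : sgraph T) (l : nat).
Hypothesis l5 : 5 <= l.
Hypothesis girth : forall c, gcycle G c -> 2 * l + 1 <= size c.
Hypothesis odd_hole_size : forall c, hole G c -> odd (size c) -> size c = 2 * l + 1.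
Hypothesis no_K4 :
  ~ (has_odd_K4_subdivision G \/ has_balanced_K4_subdivision_12 G).
Implicit Types (s t x y z u v w q p c d : T) (a b m r X : seq T).

Local Notation far := (far G).
Local Notation ipath := (ipath G).
Local Notation theta := (theta G).

Definition theta_verts s a t b r : seq T := s :: t :: a ++ b ++ r.

Lemma theta_uniq s a t b r : theta s a t b r -> uniq (theta_verts s a t b r).
Proof.
case=> -[h _ _ _] [_ ip f].
have pe : perm_eq (theta_verts s a t b r) ((s :: a ++ t :: b) ++ r).
  by apply/permP=> P; rewrite /theta_verts /= !count_cat /= ?count_cat /=; clear; lia.
rewrite (perm_uniq pe) cat_uniq (hole_uniq h) /=.
have := ipath_uniq ip; rewrite /= mem_rcons inE negb_or rcons_uniq -!andbA.
case/and4P=> st sr tr ->; rewrite andbT; apply/hasPn=> q qr.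
have := allrel_far_disjoint f qr; rewrite !(inE, mem_cat) !negb_or => /andP[-> ->] /=.
by rewrite andbT; apply/andP; split; [apply: contraNneq sr => <- | apply: contraNneq tr => <-].
Qed.

Lemma mem_theta_verts s a t b r v :
  (v \in theta_verts s a t b r) = [|| v == s, v == t, v \in a, v \in b | v \in r].
Proof. by rewrite !(inE, mem_cat). Qed.

(** Exchanging the arcs puts [z] on [a], and then [theta_claw] gives one of the excluded
    subdivisions. *)
Lemma theta_no_claw s a t b r1 c r2 z m :
  theta s a t b (r1 ++ c :: r2) -> size (r1 ++ c :: r2) <= 2 * l - 2 ->
  r1 != [::] -> r2 != [::] -> z \in a ++ b -> ipath (c :: rcons m z) ->
  (forall q v, q \in m -> v \in theta_verts s a t b (r1 ++ c :: r2) ->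
     v != c -> v != z -> far q v) -> False.
Proof.
wlog za : a b / z \in a.
  move=> W th sz r10 r20; rewrite mem_cat => /orP[za|zb] ipm fm.
    by apply: (W a b) => //; rewrite mem_cat za.
  apply: (W (rev b) (rev a)) => //; rewrite ?mem_cat ?mem_rev ?zb //.
    exact: theta_swap.
  move=> q v qm; rewrite mem_theta_verts !mem_rev => h; apply: fm => //.
  by rewrite mem_theta_verts; case/or4P: h => [->|->|->|/orP[]->]; rewrite ?orbT.
move=> th sz r10 r20 _ ipm fm; have un := theta_uniq th.
have [a1 [a2 ea]] := mem_split za; subst a.
case: (th) => -[h o _ b0] [r0 ipr fr]; case: no_K4.
apply: (theta_claw l5 girth odd_hole_size h o b0 ipr fr ipm) => //.
apply/allrelP=> q v qm vX.
have {}un : uniq (c :: z :: s :: t :: a1 ++ a2 ++ b ++ r1 ++ r2).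
  rewrite (perm_uniq (s2 := theta_verts s (a1 ++ z :: a2) t b (r1 ++ c :: r2))) //.
  by apply/permP=> P; rewrite /theta_verts /= !count_cat /= ?count_cat /=; clear; lia.
move: un; rewrite 2!cons_uniq in_cons negb_or => /and3P[/andP[_ cX] zX _].
apply: fm => //; last 2 first.
- by apply: contraNneq cX => <-.
- by apply: contraNneq zX => <-.
move: vX; rewrite mem_theta_verts !(inE, mem_cat).
by move=> /or4P[->|->|->|/or4P[]->]; rewrite ?orbT.
Qed.

(** Because [r] is as long as [b], the path from [s] through [r] to [t] lies on an odd hole closed
    by [a], to which [hole_one_neighbour] applies. *)
Lemma theta_one_neighbour s a t b r q u v :
  theta s a t b r -> size r = size b -> q \notin theta_verts s a t b r ->
  u \in s :: rcons r t -> v \in s :: rcons r t ->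
  adj G q u -> adj G q v -> u = v.
Proof.
move=> th rb qX ur vr; apply: (hole_one_neighbour l5 girth (theta_hole l5 girth th)).
- by rewrite /= size_cat /= size_rev; have := theta_size odd_hole_size th; rewrite rb; clear; lia.
- move: qX; rewrite mem_theta_verts !(inE, mem_cat, mem_rev) !negb_or.
  by case/and5P=> -> -> -> _ ->.
- by move: ur; rewrite -cat_rcons -cat_cons mem_cat => ->.
- by move: vr; rewrite -cat_rcons -cat_cons mem_cat => ->.
Qed.

(* The returning path ends at the neighbour [w] of [y1].  Leaving from [y] or [y2]
   instead, it replaces one or two inner vertices of [r], so it is too short. *)
Lemma theta_near s a t b r1 w y1 y y2 r2 p m0 (r := r1 ++ [:: w; y1; y; y2] ++ r2) :
  theta s a t b r -> size r = size b -> size a < l ->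
  path (adj G) p m0 -> {in p :: m0, forall q, q \notin theta_verts s a t b r} ->
  adj G p y -> adj G (last p m0) w ->
  (forall q v, q \in p :: m0 -> v \in theta_verts s a t b r -> adj G q v ->
     v \in [:: y1; y; y2; w]) -> False.
Proof.
move=> th rb al pm mX py lw nb; have un := theta_uniq th.
(* Common end of both cases: [be] is the stretch of [r] between [w] and [c]. It contains [y1], so
   attachments to [y1] vanish in the detour. Comparing lengths gives [size m = size be], at most
   two, while the ear bound makes [m] at least [l] long. *)
have fin be c ga m : c \in r -> s :: rcons r t = (s :: r1) ++ w :: be ++ c :: ga ->
   size be <= 2 -> m != [::] -> ipath (c :: rcons m w) -> {subset m <= p :: m0} ->
   (forall q v, q \in m -> v \in theta_verts s a t b r -> adj G q v ->
     [|| v == c, v == w | v == y1]) -> y1 \in be -> False.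
  move=> cr e be2 m0' ipm sub nbm y1be.
  have wr : w \in r by rewrite mem_cat inE eqxx orbT.
  have cw : c != w.
    by have := ipath_uniq ipm; rewrite /= mem_rcons inE negb_or -andbA => /and3P[].
  have mX' : {in rev m, forall q, q \notin theta_verts s a t b r}.
    by move=> q; rewrite mem_rev => /sub/mX.
  have unr : uniq (s :: rcons r t).
    by case: (th) => _ [_ ip _]; exact: ipath_uniq ip.
  have inX v : v \in s :: rcons r t -> v \in theta_verts s a t b r.
    rewrite mem_theta_verts !(inE, mem_rcons).
    by case/or3P=> ->; rewrite ?orbT.
  have fm : allrel far (rev m) ((s :: r1) ++ ga ++ a ++ b).
    apply/allrelP=> q v qm vv.
    have vX : v \in theta_verts s a t b r.
      move: vv; rewrite 2!mem_cat => /or3P[v1|v1|].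
      - by apply: inX; rewrite e mem_cat v1.
      - by apply: inX; rewrite e !(mem_cat, in_cons) v1 !orbT.
      - by rewrite mem_theta_verts mem_cat => /orP[]->; rewrite !orbT.
    have qX := mX' _ qm; rewrite /far; apply/andP; split.
      by apply: contraNneq qX => ->.
    apply/negP=> qv; rewrite mem_rev in qm.
    have {qv} : [|| v == c, v == w | v == y1] by exact: nbm qm vX qv.
    have nab u : u \in r -> u \notin a ++ b.
      by move=> ur; case: (th) => _ [_ _ f]; exact: allrel_far_disjoint f ur.
    have y1r : y1 \in r by rewrite mem_cat !inE eqxx !orbT.
    have : [/\ c \notin (s :: r1) ++ ga, w \notin (s :: r1) ++ ga & y1 \notin (s :: r1) ++ ga].
      have : uniq ((w :: c :: be) ++ (s :: r1) ++ ga).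
        rewrite (perm_uniq (s2 := (s :: r1) ++ w :: be ++ c :: ga)) -?e //.
        by rewrite e; apply/permP=> P; rewrite /= !count_cat /= ?count_cat /=; clear; lia.
      rewrite cat_uniq => /and3P[_ /hasPn hb _].
      by split; apply/negP=> /hb; rewrite /= !inE ?eqxx ?y1be ?orbT.
    case=> cn wn yn; move: vv; rewrite catA mem_cat => /orP[vv|vv] /or3P[]/eqP ev; subst v.
    + by rewrite vv in cn.
    + by rewrite vv in wn.
    + by rewrite vv in yn.
    + by have := nab _ cr; rewrite vv.
    + by have := nab _ wr; rewrite vv.
    + by have := nab _ y1r; rewrite vv.
  have [|r' [th' sz']] := theta_detour th e _ (ipath_flip ipm) fm.
    by rewrite rev_neq0.
  rewrite size_rev in sz'.
  have szm : size m = size be.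
    by case: (theta_length l5 girth odd_hole_size th') => -[h1 h2]; clear -h1 h2 sz' rb al; lia.
  suff /(theta_ear l5 girth odd_hole_size th rb cr wr cw m0' ipm) :
    {in m, forall q, q \notin s :: rcons r t ++ a}.
    by move: be2; rewrite szm; clear -l5; lia.
  move=> q qm.
  have := mX _ (sub _ qm); rewrite mem_theta_verts !(inE, mem_cat, mem_rcons) !negb_or.
  by case/and5P=> -> -> -> _ ->.
have ipr : ipath (s :: rcons r t) by case: (th) => _ [].
have yX v : v \in r -> v \in theta_verts s a t b r by rewrite mem_theta_verts => ->; rewrite !orbT.
have [wr yr y2r] : [/\ w \in r, y \in r & y2 \in r].
  by rewrite /r !mem_cat !inE !eqxx !orbT.
have ip4 : ipath [:: w, y1, y, y2 & rcons r2 t].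
  by move: ipr; rewrite /r rcons_cat -cat_cons => /ipath_catr.
move: ip4; rewrite ipath_cons2 /= => /and3P[_ /and3P[wy wy2 _] _].
have [|||||c [d [m [[cX dX Ac /eqP ed] [m0' ipm sub nbm]]]]] :=
   @link T G (theta_verts s a t b r) (pred2 y y2) (pred1 w) (pred1 y1) p m0 pm mX.
- by exists y; rewrite /= eqxx yX.
- by exists w; rewrite /= eqxx yX.
- move=> q v qm vX /(nb _ _ qm vX); rewrite !inE => /or4P[]->; by rewrite ?orbT.
- move=> q u v qm uX vX; case/orP=> [/andP[/pred2P hu /pred2P hv]|/andP[/eqP-> /eqP->]] //.
  apply: (theta_one_neighbour th rb (mX _ qm)).
    by rewrite inE mem_rcons inE; case: hu => ->; rewrite ?yr ?y2r !orbT.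
  by rewrite inE mem_rcons inE; case: hv => ->; rewrite ?yr ?y2r !orbT.
- by move=> c d _ _ /pred2P[->|->] /eqP->; rewrite farC.
subst d; case/pred2P: Ac => ec; subst c.
  apply: (fin [:: y1] y (y2 :: rcons r2 t) m) => //; last by rewrite inE eqxx.
  by rewrite /r rcons_cat.
apply: (fin [:: y1; y] y2 (rcons r2 t) m) => //; last by rewrite inE eqxx.
by rewrite /r rcons_cat.
Qed.

End ThetaAttachments.

(** * Excluding thetas *)

Section NoTheta.
Variables (T : finType) (G : sgraph T) (l : nat).
Hypothesis l5 : 5 <= l.
Hypothesis girth : forall c, gcycle G c -> 2 * l + 1 <= size c.
Hypothesis odd_hole_size : forall c, hole G c -> odd (size c) -> size c = 2 * l + 1.
Hypothesis no_K4 :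
  ~ (has_odd_K4_subdivision G \/ has_balanced_K4_subdivision_12 G).
Hypothesis no_P3_cut : ~ has_P3_cut G.
Hypothesis no_deg2 : ~ exists v, v \in verts G /\ deg G v = 2.
Implicit Types (s t x y z u v w q p c d : T) (a b m r X : seq T).

Local Notation far := (far G).
Local Notation ipath := (ipath G).
Local Notation theta := (theta G).

(** If [u] were an end of [r], then [q] and [u] would form an ear with two inner vertices on the odd
    hole, which is too short. So [u] has vertices of [r] on both sides, and [q] alone is the
    connecting path forbidden by [theta_no_claw]. *)
Lemma theta_no_double_neighbour s a t b r q u v :
  theta s a t b r -> size r = size b -> size r <= 2 * l - 2 ->
  q \notin theta_verts s a t b r -> u \in r -> v \in a ++ b ->
  adj G q u -> adj G q v -> False.
Proof.
move=> th rb r2l qX ur vab qu qv.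
case: (th) => -[h o _ _] [_ ipr _].
have hsz := odd_hole_size h o.
have vC : v \in s :: a ++ t :: b.
  by move: vab; rewrite !(inE, mem_cat) => /orP[]->; rewrite ?orbT.
have qC : q \notin s :: a ++ t :: b.
  by move: qX; rewrite mem_theta_verts !(inE, mem_cat) !negb_or => /and5P[-> -> -> -> _].
have uC : u \notin s :: a ++ t :: b.
  have := theta_uniq th.
  rewrite (perm_uniq (s2 := (s :: a ++ t :: b) ++ r)).
    by rewrite cat_uniq => /and3P[_ /hasPn/(_ _ ur)].
  by apply/permP=> P; rewrite /theta_verts /= !count_cat /= ?count_cat /=; clear; lia.
have noear d : d \in s :: a ++ t :: b -> v != d -> ~~ adj G u d.
  move=> dC vd; apply/negP=> ud.
  have uq : uniq [:: q; u] by rewrite /= inE (adj_neq qu).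
  have pq : path (adj G) v (rcons [:: q; u] d) by rewrite /= adj_sym qv qu ud.
  have := ear_length l5 girth h hsz vC dC vd (isT : [:: q; u] != [::]) pq uq.
  have hq : {in [:: q; u], forall x, x \notin s :: a ++ t :: b}.
    by move=> x; rewrite !inE => /orP[]/eqP->.
  by move=> /(_ hq); clear -l5; rewrite /=; lia.
have hu := hole_uniq h.
have vs : v != s.
  apply: contraTneq hu => e; move: vab; rewrite e /= !mem_cat inE.
  by case/orP=> ->; rewrite ?orbT.
have vt : v != t.
  apply: contraTneq hu => e; move: vab; rewrite e /= cat_uniq /= mem_cat.
  by case/orP=> ->; rewrite ?andbF.
have [r1 [r2 er]] := mem_split ur; subst r.
have r10 : r1 != [::].
  have sC : s \in s :: a ++ t :: b by rewrite inE eqxx.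
  apply: contraNneq (noear s sC vs) => e.
  by move: ipr; rewrite e rcons_cons ipath_cons2 adj_sym => /and3P[].
have r20 : r2 != [::].
  have tC : t \in s :: a ++ t :: b by rewrite !(inE, mem_cat) eqxx !orbT.
  apply: contraNneq (noear t tC vt) => e.
  move: ipr; rewrite e -cats1 -catA -cat_cons ipath_cat ipath_cons2.
  by case/and3P=> _ /andP[].
apply: (theta_no_claw l5 girth odd_hole_size no_K4 (m := [:: q]) th r2l r10 r20 vab).
  rewrite rcons_cons ipath_cons2 adj_sym qu /= qv /= !andbT.
  case: (th) => _ [_ _ /allrelP]; exact.
move=> x w; rewrite inE => /eqP-> wX wu wv; rewrite /far; apply/andP; split.
  by apply: contraNneq qX => ->.
apply/negP=> qw; move: (wX); rewrite mem_theta_verts => wX'.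
have [wC|wC] := boolP (w \in s :: a ++ t :: b).
  case/eqP: wv; exact: (hole_one_neighbour l5 girth h hsz qC).
case/eqP: wu; apply: (theta_one_neighbour l5 girth odd_hole_size th rb qX) qw qu.
  move: wC wX'; rewrite !(inE, mem_cat, mem_rcons) !negb_or => /and4P[/negbTE-> /negbTE-> /negbTE-> /negbTE->] /= ->.
  by [].
by rewrite inE mem_rcons inE ur !orbT.
Qed.

(** Strong induction on [size r]: every configuration is either excluded outright or yields a theta
    with a shorter third path. *)
Lemma no_theta s a t b r : ~ theta s a t b r.
Proof.
elim: {r}(size r).+1 {-2}r (ltnSn (size r)) s a t b => // n IH r rn s a t b th.
wlog [rb lb] : a b th / size r = size b /\ l <= size b.
  move=> W; case: (theta_length l5 girth odd_hole_size th) => h; first exact: W th h.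
  by apply: (W _ _ (theta_swap th)); rewrite size_rev.
have sz := theta_size odd_hole_size th.
have al : size a < l by clear -sz lb; lia.
have a1 : 0 < size a by case: (th) => -[_ _ a0 _] _; rewrite lt0n size_eq0.
have r2l : size r <= 2 * l - 2 by clear -sz rb a1; lia.
have r5 : 4 < size r by rewrite rb; exact: leq_trans l5 lb.
set X := theta_verts s a t b r.
(* The bound on [l] gives [r] at least five vertices, so the path [y1], [y], [y2] to be deleted has
   both its neighbours [w] and [h] still inside [r]. *)
have [w [y1 [y [y2 [h [r2 er]]]]]] : exists w y1 y y2 h r2, r = [:: w, y1, y, y2, h & r2].
  case: (r) r5 => [|w [|y1 [|y [|y2 [|h r2]]]]] // _; by exists w, y1, y, y2, h, r2.
set N := [:: y1; y; y2].
case: (th) => -[hC oC _ _] [_ ipr fr]; have hsz := odd_hole_size hC oC.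
have NX c v : c \in N -> v \in X -> adj G c v -> v \in [:: w; y1; y; y2; h].
  move=> cN vX cv; move: ipr; rewrite er !rcons_cons 5!ipath_cons2 /=.
  move=> /and3P[_ /and5P[s1 s2 s3 s4 _] /and3P[_ _ /and3P[_ /and3P[_ _ f1] /and3P[_ /andP[_ f2] /and3P[_ f3 _]]]]].
  have cr : c \in r by move: cN; rewrite er !inE => /or3P[]->; rewrite ?orbT.
  have fc u : u \in s :: rcons r2 t -> far c u.
    rewrite in_cons => /orP[/eqP->|ur2].
      by move: cN; rewrite farC !inE => /or3P[]/eqP->.
    by move: cN; rewrite !inE => /or3P[]/eqP->; [exact: (allP f1)|exact: (allP f2)|exact: (allP f3)].
  have nfc u : far c u -> u != v by rewrite /far => /andP[_]; apply: contraNneq => ->.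
  move: vX; rewrite mem_theta_verts er => /or4P[/eqP ev|/eqP ev|va|/orP[vb|]].
  - by have := nfc _ (fc s (mem_head _ _)); rewrite ev eqxx.
  - by have := nfc t (fc t _); rewrite ev eqxx inE mem_rcons mem_head orbT => /(_ isT).
  - by have := nfc v; rewrite eqxx => /(_ _)/negP[] //; move/allrelP: fr; apply; rewrite ?mem_cat ?va.
  - by have := nfc v; rewrite eqxx => /(_ _)/negP[] //; move/allrelP: fr; apply; rewrite ?mem_cat ?vb ?orbT.
  rewrite !inE => /or4P[->|->|->|/or3P[->|->|vr2]]; rewrite ?orbT //.
  by have := nfc v (fc v _); rewrite eqxx inE mem_rcons inE vr2 !orbT => /(_ isT).
move: (ipr); rewrite er !rcons_cons 5!ipath_cons2 /=.
move=> /and3P[sw /and5P[sy1 sy sy2 _ _] /and3P[_ /and3P[wy _ _] /and3P[y1y /andP[/andP[n12 _] _] /and3P[yy2 /andP[yh _] _]]]].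
have unX := theta_uniq th; rewrite -/X in unX.
have rX v : v \in r -> v \in X by rewrite mem_theta_verts => ->; rewrite !orbT.
have Nr v : v \in N -> v \in r by rewrite er !inE => /or3P[]->; rewrite ?orbT.
have yy1 : adj G y y1 by rewrite adj_sym.
have [v [yv v1 v2]] := third_neighbour no_deg2 yy1 yy2 n12.
have vX : v \notin X.
  apply/negP=> vX; have := NX y v; rewrite !inE eqxx orbT => /(_ isT vX yv).
  case/or4P=> [/eqP e|e|/eqP e|/orP[e|/eqP e]].
  - by move: wy; rewrite farC /far -e yv andbF.
  - by rewrite e in v1.
  - by rewrite e adj_irr in yv.
  - by rewrite e in v2.
  - by move: yh; rewrite /far -e yv andbF.
have vN : v \notin N by apply: contra vX => /Nr/rX.
have sX : s \in X by rewrite inE eqxx.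
have sN : s \notin N.
  by rewrite !inE !negb_or; case/andP: sy1 => ->; case/andP: sy => ->; case/andP: sy2 => ->.
have vG : v \in verts G by apply: (@adj_verts _ G v y); rewrite adj_sym.
have [r0 [z0 [pr0 r0X z0X z0N lz0]]] :=
  escape no_P3_cut yy1 yy2 n12 vG vX vN (adj_verts sw) sX sN.
(* The escaping path is trimmed so that only its first vertex sees [y] and only its last one has a
   neighbour in the theta outside [N]. *)
pose far_nbr q := has (fun u => (u \notin N) && adj G q u) X.
have [|||p [m0 [ip0 /allP m0X [yp /hasP[z zX /andP[zN lz]]] m0y m0z]]] :=
  @path_between T G (adj G y) far_nbr [predC X] v r0 pr0.
- exact/allP.
- exact: yv.
- by apply/hasP; exists z0; rewrite // z0N.
have {}m0X : {in p :: m0, forall q, q \notin X} by move=> q /m0X.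
have uniqN q u u' : q \notin X -> u \in N -> u' \in N -> adj G q u -> adj G q u' -> u = u'.
  move=> qX uN uN'; apply: (theta_one_neighbour l5 girth odd_hole_size th rb qX).
    by rewrite inE mem_rcons inE Nr // !orbT.
  by rewrite inE mem_rcons inE Nr // !orbT.
(* Two neighbours on the odd hole, or two on the path through [r], contradict the one-neighbour
   bounds; the mixed case is [theta_no_double_neighbour]. *)
have uniqZ q u u' : q \notin X -> u \in X -> u' \in X -> adj G q u -> adj G q u' -> u = u'.
  move=> qX uX uX' qu qu'.
  have qC : q \notin s :: a ++ t :: b.
    by move: qX; rewrite mem_theta_verts !(inE, mem_cat) !negb_or => /and5P[-> -> -> -> _].
  have mix u1 u2 : u1 \in X -> u2 \in X -> u1 \notin s :: a ++ t :: b ->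
      adj G q u1 -> adj G q u2 -> u1 = u2.
    move=> u1X u2X u1C q1 q2.
    have u1r : u1 \in r.
      move: u1X u1C; rewrite mem_theta_verts !(inE, mem_cat) !negb_or.
      by move=> h1 /and4P[/negbTE e1 /negbTE e2 /negbTE e3 /negbTE e4]; move: h1; rewrite e1 e2 e3 e4.
    have [u2ab|u2ab] := boolP (u2 \in a ++ b).
      by case: (theta_no_double_neighbour th rb r2l qX u1r u2ab).
    apply: (theta_one_neighbour l5 girth odd_hole_size th rb qX) => //.
      by rewrite inE mem_rcons inE u1r !orbT.
    move: u2X u2ab; rewrite mem_theta_verts !(inE, mem_cat, mem_rcons) negb_or.
    by move=> h1 /andP[/negbTE e1 /negbTE e2]; move: h1; rewrite e1 e2.
  have [uC|uC] := boolP (u \in s :: a ++ t :: b); last exact: mix.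
  have [uC'|uC'] := boolP (u' \in s :: a ++ t :: b); last by apply/esym/mix.
  exact: (hole_one_neighbour l5 girth hC hsz qC).
have nb q u : q \in p :: m0 -> u \in X -> adj G q u -> (u \in N) || (u == z).
  move=> qm uX qu; have [//|uN] := boolP (u \in N).
  have eq : q = last p m0 by apply: m0z => //; apply/hasP; exists u; rewrite // uN.
  by rewrite (uniqZ q u z) ?eqxx ?m0X // eq.
have py : adj G p y by rewrite adj_sym.
have pm0 : path (adj G) p m0 by exact: (ipath_sorted ip0).
(* If [z] is [w] or [h], it is adjacent to [y1] or [y2], so [N] and [z] are not far apart as [link]
   requires. These cases go to [theta_near], read backwards for [h]. *)
have [ezw|zw] := eqVneq z w.
  have er' : r = [::] ++ [:: w; y1; y; y2] ++ (h :: r2) by rewrite er.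
  have := @theta_near T G l l5 girth odd_hole_size s a t b [::] w y1 y y2 (h :: r2) p m0.
  rewrite -er' -ezw => nth; apply: nth => // q u qm uX /(nb _ _ qm uX).
  by rewrite !inE -!orbA.
have [ezh|zh] := eqVneq z h.
  have er' : rev r = rev r2 ++ [:: h; y2; y; y1] ++ [:: w].
    by rewrite er !rev_cons -!cats1 -!catA.
  have XE u : (u \in theta_verts t (rev a) s (rev b) (rev r)) = (u \in X).
    by rewrite !mem_theta_verts !mem_rev orbCA.
  have := @theta_near T G l l5 girth odd_hole_size t (rev a) s (rev b) (rev r2) h y2 y y1 [:: w] p m0.
  rewrite -er' -ezh => nth; apply: nth; rewrite ?size_rev //.
  - exact: theta_rev.
  - by move=> q qm; rewrite XE; exact: m0X.
  move=> q u qm; rewrite XE => uX /(nb _ _ qm uX).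
  by rewrite !inE -!orbA => /or4P[]->; rewrite ?orbT.
have [|||||c [d [m [[cX _ cN /eqP ed] [m0' ipm sub nbm]]]]] :=
  @link T G X (mem N) (pred1 z) pred0 p m0 pm0 m0X.
- by exists y; rewrite /= !inE eqxx orbT; split=> //; apply: rX; rewrite er !inE eqxx !orbT.
- by exists z; rewrite /= eqxx.
- by move=> q u qm uX /(nb _ _ qm uX); rewrite /= orbF.
- move=> q u u' qm uX uX' /orP[/andP[/= uN uN']|/andP[/eqP-> /eqP->]//].
  by apply: uniqN => //; exact: m0X.
- move=> c d cX _ /= cN /eqP->; rewrite /far; apply/andP; split.
    by apply: contraNneq zN => <-.
  apply/negP=> /(NX _ _ cN zX); rewrite !inE (negbTE zw) (negbTE zh) orbF /=.
  by move: zN; rewrite !inE => /negbTE->.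
subst d; have farm q u : q \in m -> u \in X -> u != c -> u != z -> far q u.
  move=> qm uX uc uz; rewrite /far; apply/andP; split.
    by apply: contraNneq (m0X _ (sub _ qm)) => ->.
  by apply/negP=> /(nbm _ _ qm uX); rewrite (negbTE uc) (negbTE uz).
have {cN} cN : c \in N by [].
have [zab|zab] := boolP (z \in a ++ b).
  have [r1 [r2' [er1 r10 r20]]] : exists r1 r2', [/\ r = r1 ++ c :: r2', r1 != [::] & r2' != [::]].
    move: cN; rewrite er !inE => /or3P[]/eqP->.
    - by exists [:: w], [:: y, y2, h & r2].
    - by exists [:: w; y1], [:: y2, h & r2].
    - by exists [:: w; y1; y], [:: h & r2].
  apply: (@theta_no_claw T G l l5 girth odd_hole_size no_K4 s a t b r1 c r2' z m) => //;
    rewrite -?er1 //.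
have zr : z \in s :: rcons r t.
  move: zX zab; rewrite mem_theta_verts !(inE, mem_cat, mem_rcons) negb_or.
  by move=> h1 /andP[/negbTE e1 /negbTE e2]; move: h1; rewrite e1 e2.
have cr : c \in s :: rcons r t by rewrite inE mem_rcons inE Nr ?orbT.
have uP := ipath_uniq ipr.
have cs : c != s by apply: contraNneq sN => <-.
have ct : c != t.
  move: uP; rewrite /= rcons_uniq => /and3P[_ tr _].
  by apply: contraNneq tr => <-; exact: Nr.
have cz : c != z by apply: contraNneq zN => <-.
(* Here [e1] and [e2] are [c] and [z] in their order along the path. As [c] is neither [s] nor [t],
   some part of the path lies outside the detour, and the induction hypothesis refutes the shorter
   theta. *)
have sub_fin lf be ga e1 e2 m' : {subset m' <= m} -> {subset [:: e1; e2] <= [:: c; z]} ->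
    {subset [:: c; z] <= [:: e1; e2]} ->
    s :: rcons r t = lf ++ e1 :: be ++ e2 :: ga ->
    (lf != [::]) || (ga != [::]) -> m' != [::] -> ipath (e1 :: rcons m' e2) -> False.
  move=> sm se se' e ne m'0 ipm'.
  have [|s' [a' [t' [b' [r' [th' lt']]]]]] :=
    theta_detour_smaller l5 girth odd_hole_size th rb al e ne m'0 ipm'.
    apply/allrelP=> q u /sm qm uu.
    have un2 : uniq ((e1 :: e2 :: lf ++ be ++ ga) ++ a ++ b).
      rewrite (perm_uniq (s2 := (lf ++ e1 :: be ++ e2 :: ga) ++ a ++ b)).
        rewrite -e (perm_uniq (s2 := X)) //.
        by apply/permP=> P; rewrite /X /theta_verts /= -cats1 !count_cat /=; clear; lia.
      by apply/permP=> P; rewrite /= !count_cat /= ?count_cat /=; clear; lia.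
    have uX : u \in X.
      have : u \in (s :: rcons r t) ++ a ++ b.
        rewrite e; move: uu; rewrite !(mem_cat, in_cons).
        by case/or4P=> [->|->|->|/orP[]->]; rewrite ?orbT.
      rewrite mem_theta_verts !(mem_cat, in_cons, mem_rcons).
      by case/orP=> [/or3P[]|/orP[]] ->; rewrite ?orbT.
    have ue x : x \in [:: c; z] -> u != x.
      move/se'; move: un2; rewrite 2!cat_cons 2!cons_uniq in_cons negb_or.
      rewrite -2!catA => /and3P[/andP[_ ne1] ne2 _]; rewrite !inE => /orP[]/eqP->.
        by apply: contraNneq ne1 => <-.
      by apply: contraNneq ne2 => <-.
    by apply: farm => //; apply: ue; rewrite !inE eqxx ?orbT.
  apply: (IH r' _ s' a' t' b') th'; clear -lt' rn; lia.
have [l1 [l2 el]] := mem_split cr.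
move: (zr); rewrite el mem_cat inE eq_sym (negbTE cz) /= => /orP[/mem_split|/mem_split] [l3 [l4 e]].
  apply: (sub_fin l3 l4 l2 z c (rev m)); rewrite ?rev_neq0 ?el ?e -?catA //.
  - by move=> q; rewrite mem_rev.
  - by move=> q; rewrite !inE orbC.
  - by move=> q; rewrite !inE orbC.
  - rewrite orbC; case: (l2) el => [el|x l2' _] //.
    have := congr1 (last s) el; rewrite /= last_rcons last_cat /= => etc.
    by rewrite etc eqxx in ct.
  - exact: ipath_flip.
apply: (sub_fin l1 l3 l4 c z m); rewrite ?el ?e //.
by case: (l1) el => // -[es _]; rewrite es eqxx in cs.
Qed.

End NoTheta.

(** * Local jumps *)

Section LocalJumps.
Variables (T : finType) (G : sgraph T) (l : nat).
Hypothesis l5 : 5 <= l.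
Hypothesis girth : forall c, gcycle G c -> 2 * l + 1 <= size c.
Hypothesis odd_hole_size : forall c, hole G c -> odd (size c) -> size c = 2 * l + 1.
Hypothesis no_K4 :
  ~ (has_odd_K4_subdivision G \/ has_balanced_K4_subdivision_12 G).
Hypothesis no_P3_cut : ~ has_P3_cut G.
Hypothesis no_deg2 : ~ exists v, v \in verts G /\ deg G v = 2.
Implicit Types (s t x y z u v w q p c d e : T) (a b m r C P R : seq T).

Local Notation far := (far G).
Local Notation ipath := (ipath G).

(** With [E] empty, [link] leaves a path whose only attachments are one vertex of [A] and one of
    [B]. They are nonadjacent, so this is a theta over [C]. *)
Lemma no_connector C (A B : pred T) p m :
  hole G C -> odd (size C) ->
  path (adj G) p m -> {in p :: m, forall q, q \notin C} ->
  (exists c, [/\ c \in C, A c & adj G p c]) ->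
  (exists d, [/\ d \in C, B d & adj G (last p m) d]) ->
  (forall q v, q \in p :: m -> v \in C -> adj G q v -> A v || B v) ->
  (forall c d, c \in C -> d \in C -> A c -> B d -> far c d) -> False.
Proof.
move=> h o pm mC exA exB nb ff; have sz := odd_hole_size h o.
have [||c [d [m' [[cC dC Ac Bd] [m0 ipm sub nbm]]]]] :=
  @link T G C A B pred0 p m pm mC exA exB _ _ ff.
- by move=> q v qm vC /(nb _ _ qm vC); rewrite orbF.
- move=> q u v qm uC vC _; exact: (hole_one_neighbour l5 girth h sz (mC _ qm)).
have /andP[cd ncd] := ff c d cC dC Ac Bd.
have [a [b [h' memC sz']]] := hole_pair h cC dC cd.
case: (no_theta l5 girth odd_hole_size no_K4 no_P3_cut no_deg2 (s := c) (a := a) (t := d) (b := b) (r := m')).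
have un := hole_uniq h'.
split; split=> //.
- by rewrite -sz'.
- apply: contraNneq ncd => e; move: h'; rewrite e => -[/and3P[_ _]] /=.
  by case/andP.
- apply: contraNneq ncd => e; have := hole_rotC (s1 := c :: a) h'; rewrite e.
  by case=> /and3P[_ _] /= /andP[]; rewrite adj_sym.
apply/allrelP=> q v qm vab.
have qC : q \notin C by exact/mC/sub.
have vC : v \in C.
  by rewrite memC; move: vab; rewrite !(inE, mem_cat) => /orP[]->; rewrite ?orbT.
rewrite /far; apply/andP; split; first by apply: contraNneq qC => ->.
apply/negP=> /(nbm _ _ qm vC); rewrite orbF => ev.
move: un; rewrite (perm_uniq (s2 := c :: d :: a ++ b)); last first.
  by apply/permP=> Q; rewrite /= !count_cat /=; clear; lia.
rewrite 2!cons_uniq in_cons negb_or => /and3P[/andP[_ cn] dn _].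
by case/orP: ev => /eqP e; move: vab; rewrite e ?(negbTE cn) ?(negbTE dn).
Qed.

(* It is not required that [x] be attached to [m]; without attachment [m] would
   form a theta with [C]. *)
Definition local_jump C s x t m : Prop :=
  [/\ m != [::], ipath (s :: rcons m t), {in m, forall q, q \notin C} &
      forall q v, q \in m -> v \in C -> adj G q v -> v \in [:: s; x; t]].

Lemma local_jump_flip C s x t m :
  local_jump C s x t m -> local_jump C t x s (rev m).
Proof.
case=> m0 ip mC nb; split; rewrite ?rev_neq0 //; first exact: ipath_flip.
  by move=> q; rewrite mem_rev; exact: mC.
move=> q v; rewrite mem_rev => qm vC /(nb _ _ qm vC).
by rewrite !inE => /or3P[]->; rewrite ?orbT.
Qed.

Lemma local_jump_mem C C' s x t m :
  C =i C' -> local_jump C s x t m -> local_jump C' s x t m.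
Proof.
move=> e [m0 ip mC nb]; split=> //; first by move=> q; rewrite -e; exact: mC.
by move=> q v qm; rewrite -e; exact: nb.
Qed.

(** No vertex of the path sees [y1]: the first one already sees [y], and from a later one the rest
    of the path would connect [y1] to [y2] and [z], against [no_connector]. Then [link] from [y] to
    [z], tolerating [y2], gives the jump. *)
Lemma local_jump_of_path y1 y y2 z e r p m (C := [:: y1, y, y2, z, e & r]) :
  hole G C -> odd (size C) ->
  path (adj G) p m -> {in p :: m, forall q, q \notin C} ->
  adj G p y -> {in m, forall q, ~~ adj G q y} -> adj G (last p m) z ->
  (forall q v, q \in p :: m -> v \in C -> adj G q v -> v \in [:: y1; y; y2; z]) ->
  exists m', local_jump C y y2 z m'.
Proof.
move=> h o pm mC py my lz nb; have sz := odd_hole_size h o.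
have ip : ipath [:: y1; y; y2; z] by exact: (@hole_ipath T G _ e r).
move: ip; rewrite 3!ipath_cons2 /= !andbT => /and3P[_ /andP[f1 f2] /and3P[_ f3 _]].
have [y1C yC zC] : [/\ y1 \in C, y \in C & z \in C].
  by rewrite !inE !eqxx !orbT.
have un1 q u v : q \in p :: m -> u \in C -> v \in C -> adj G q u -> adj G q v -> u = v.
  by move=> qm; apply: (hole_one_neighbour l5 girth h sz (mC _ qm)).
have y1y : y1 != y by have := hole_uniq h; rewrite /= !inE !negb_or => /andP[/andP[]].
have ny1 q : q \in p :: m -> ~~ adj G q y1.
  move=> qm; apply/negP=> qy1.
  have {}qm : q \in m.
    move: (qm); rewrite inE => /orP[/eqP ep|//]; move: y1y.
    by rewrite (un1 q y1 y) ?eqxx // ep.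
  have [u1 [u2 em]] := mem_split qm.
  have sub v : v \in q :: u2 -> v \in m by rewrite em mem_cat => ->; rewrite orbT.
  apply: (@no_connector C (pred1 y1) (pred2 y2 z) q u2) => //.
  - by move: pm; rewrite em cat_path /= => /and3P[].
  - by move=> v /sub vm; apply: mC; rewrite inE vm orbT.
  - by exists y1; rewrite /= eqxx.
  - by exists z; rewrite /= eqxx orbT; split=> //; move: lz; rewrite em last_cat.
  - move=> v w /sub vm wC vw; have vm' : v \in p :: m by rewrite inE vm orbT.
    have := nb _ _ vm' wC vw; rewrite !inE => /or4P[]/eqP ew; rewrite ew /= ?eqxx ?orbT //.
    by move: (my _ vm); rewrite -ew vw.
  - by move=> c d _ _ /eqP-> /pred2P[]->.
have [|||||c [d [m' [[_ _ /eqP-> /eqP->] [m0 ipm sub nbm]]]]] :=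
  @link T G C (pred1 y) (pred1 z) (pred1 y2) p m pm mC.
- by exists y; rewrite /= eqxx.
- by exists z; rewrite /= eqxx.
- move=> q v qm vC qv; have := nb _ _ qm vC qv; rewrite !inE => /or4P[]/eqP ev;
    rewrite ev /= ?eqxx ?orbT //.
  by move: (ny1 _ qm); rewrite -ev qv.
- by move=> q u v qm uC vC _; exact: un1.
- by move=> c d _ _ /eqP-> /eqP->.
exists m'; split=> //; first by move=> q /sub/mC.
move=> q v qm vC /(nbm _ _ qm vC); rewrite !inE.
by case/or3P=> ->; rewrite ?orbT.
Qed.

(** A third neighbour of [y] and the absence of a $P_3$-cut give a path from [y] to a vertex [z] of
    [C] outside [N]. Being nonadjacent to [N] would contradict [no_connector], so [z] is one of the
    two vertices [e1], [e2] next to [N]. *)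
Lemma local_jump_exists y1 y y2 e1 r e2 (C := [:: y1, y, y2, e1 & rcons r e2]) :
  hole G C -> odd (size C) -> r != [::] ->
  (exists m, local_jump C y y2 e1 m) \/ (exists m, local_jump C y y1 e2 m).
Proof.
move=> h o r0; have sz := odd_hole_size h o.
have un := hole_uniq h.
have ip1 : ipath [:: y1, y, y2, e1 & r].
  by apply: (@hole_ipath T G _ e2 [::]); rewrite -[_ ++ _]/[:: y1, y, y2, e1 & r ++ [:: e2]] cats1.
have [r' [f er]] : exists r' f, r = rcons r' f.
  by case/lastP: (r) r0 => // r' f _; exists r', f.
have ip2 : ipath [:: e2, y1, y, y2, e1 & r'].
  apply: (@hole_ipath T G _ f [::]).
  have -> : [:: e2, y1, y, y2, e1 & r'] ++ [:: f] = [:: e2] ++ [:: y1, y, y2, e1 & r].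
    by rewrite er /= cats1.
  by apply: hole_rotC; rewrite /= cats1.
move: (ip1) (ip2); rewrite 3!ipath_cons2 4!ipath_cons2 /=.
move=> /and3P[y1y /andP[f1 /andP[f2 f3]] /and3P[yy2 /andP[f4 f5] /and3P[y2e1 f6 _]]].
move=> /and3P[_ /and3P[g1 g2 _] _].
set N := [:: y1; y; y2].
have CE v : (v \in C) = (v \in N) || (v \in [:: e1, e2 & r]).
  by rewrite !inE mem_rcons inE !orbA.
have unN v : v \in [:: e1, e2 & r] -> v \notin N.
  move=> vr; apply/negP=> vN; move: un; rewrite (perm_uniq (s2 := N ++ [:: e1, e2 & r])).
    by rewrite cat_uniq => /and3P[_ /hasPn/(_ _ vr)]; rewrite /= vN.
  by apply/permP=> Q; rewrite /= -cats1 count_cat /=; clear; lia.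
have n12 : y1 != y2 by case/andP: f1.
have yy1 : adj G y y1 by rewrite adj_sym.
have [v [yv v1 v2]] := third_neighbour no_deg2 yy1 yy2 n12.
have vC : v \notin C.
  rewrite CE negb_or; apply/andP; split.
    rewrite !inE !negb_or v1 v2 andbT /= eq_sym; exact: adj_neq yv.
  apply/negP; rewrite !inE => /or3P[/eqP e|/eqP e|e].
  - by move: f4; rewrite -e /far yv andbF.
  - by move: g1; rewrite farC -e /far yv andbF.
  - by move/(allP f5): e; rewrite /far yv andbF.
have vN : v \notin N by move: vC; rewrite CE negb_or => /andP[].
have e1C : e1 \in C by rewrite !inE eqxx !orbT.
have e1N : e1 \notin N by apply: unN; rewrite inE eqxx.
have vG : v \in verts G by apply: (@adj_verts _ G v y); rewrite adj_sym.
have e1G : e1 \in verts G by apply: (@adj_verts _ G e1 y2); rewrite adj_sym.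
have [r0' [z0 [pr0 r0C z0C z0N lz0]]] :=
  escape no_P3_cut yy1 yy2 n12 vG vC vN e1G e1C e1N.
pose far_nbr q := has (fun u => (u \notin N) && adj G q u) C.
have [|||p [m [ipm /allP mC' [yp /hasP[z zC /andP[zN lz]]] my mz]]] :=
  @path_between T G (adj G y) far_nbr [predC C] v r0' pr0.
- exact/allP.
- exact: yv.
- by apply/hasP; exists z0; rewrite // z0N.
have mC : {in p :: m, forall q, q \notin C} by move=> q /mC'.
have un1 q u u' : q \notin C -> u \in C -> u' \in C -> adj G q u -> adj G q u' -> u = u'.
  exact: (hole_one_neighbour l5 girth h sz).
have nb q u : q \in p :: m -> u \in C -> adj G q u -> (u \in N) || (u == z).
  move=> qm uC qu; have [//|uN] := boolP (u \in N).
  have eq : q = last p m by apply: mz => //; apply/hasP; exists u; rewrite // uN.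
  by rewrite (un1 q u z) ?eqxx ?mC // eq.
have py : adj G p y by rewrite adj_sym.
have pm : path (adj G) p m by exact: (ipath_sorted ipm).
have my' : {in m, forall q, ~~ adj G q y} by move=> q /my; rewrite adj_sym.
have NC u : u \in N -> u \in C by rewrite CE => ->.
have : (z == e1) || (z == e2).
  apply: contraT; rewrite negb_or => /andP[ze1 ze2].
  have zr : z \in r by move: zC; rewrite CE (negbTE zN) !inE (negbTE ze1) (negbTE ze2).
  case: (@no_connector C (mem N) (pred1 z) p m) => //.
  - by exists y; rewrite /= !inE eqxx !orbT.
  - by exists z; rewrite /= eqxx.
  - move=> c d _ _ /= cN /eqP->; move: cN; rewrite !inE => /or3P[]/eqP->.
    + exact: (allP f3).
    + exact: (allP f5).
    + exact: (allP f6).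
have nb4 q u : q \in p :: m -> u \in C -> adj G q u -> u \in [:: y1; y; y2; z].
  by move=> qm uC /(nb _ _ qm uC); rewrite !inE -!orbA.
case/orP=> /eqP ez; subst z; [left|right].
  have [f0 [r1 er1]] : exists f0 r1, rcons r e2 = f0 :: r1.
    by case: (r) => [|f0 r1]; [exists e2, [::] | exists f0, (rcons r1 e2)].
  have := @local_jump_of_path y1 y y2 e1 f0 r1 p m.
  by rewrite -er1 -/C => H; apply: H.
(* The case [z = e2] is the previous one for the hole read backwards from [y2]. *)
have [f0 [r1 er1]] : exists f0 r1, rcons (rev r) e1 = f0 :: r1.
  by case: (rev r) => [|f0 r1]; [exists e1, [::] | exists f0, (rcons r1 e1)].
set C' := [:: y2, y, y1, e2 & rcons (rev r) e1].
have eC : C' = [:: y2; y; y1] ++ rev (e1 :: rcons r e2).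
  by rewrite rev_cons rev_rcons.
have h' : hole G C'.
  rewrite eC; apply: hole_rotC; rewrite -[[:: y2; y; y1]]/(rev [:: y1; y; y2]) -rev_cat.
  exact: hole_rev.
have szC : size C' = size C by rewrite /= !size_rcons size_rev.
have memC u : (u \in C') = (u \in C).
  rewrite /C' !in_cons !mem_rcons !in_cons mem_rev.
  by case: (u == y1); case: (u == y); case: (u == y2); case: (u == e1); case: (u == e2).
have := @local_jump_of_path y2 y y1 e2 f0 r1 p m.
rewrite -er1 -/C' => H; case: H => //.
- by rewrite szC.
- by move=> q qm; rewrite memC; exact: mC.
- move=> q u qm; rewrite memC => uC /(nb4 _ _ qm uC); rewrite !inE.
  by case/or4P=> ->; rewrite ?orbT.
by move=> m' lj; exists m'; exact: local_jump_mem lj.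
Qed.

Lemma hole_replace s x t r m :
  hole G [:: s, x, t & r] -> r != [::] -> ipath (s :: rcons m t) -> allrel far m r ->
  hole G (s :: m ++ t :: r).
Proof.
move=> h r0 ipm fm; have [_ ip _] := hole_split (s1 := [:: x]) h isT r0.
exact: (hole_of_ipaths2 l5 girth).
Qed.

Lemma local_jump_far C s x t m r :
  local_jump C s x t m -> {subset r <= C} -> {in r, forall v, v \notin [:: s; x; t]} ->
  allrel far m r.
Proof.
move=> [_ _ mC nb] rC rn; apply/allrelP=> q v qm vr.
rewrite /far; apply/andP; split.
  by apply: contraNneq (mC _ qm) => ->; exact: rC.
by apply/negP=> /(nb _ _ qm (rC _ vr)); apply/negP; exact: rn.
Qed.

Lemma local_jump_long C s x t m :
  hole G C -> odd (size C) -> s \in C -> t \in C -> local_jump C s x t m -> 1 < size m.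
Proof.
move=> h o sC tC [m0 ip mC nb].
have st : s != t.
  by have := ipath_uniq ip; rewrite /= mem_rcons inE negb_or -andbA => /and3P[].
have um : uniq m by have := ipath_uniq ip; rewrite /= rcons_uniq => /and3P[].
have := ear_length l5 girth h (odd_hole_size h o) sC tC st m0 (ipath_sorted ip) um mC.
by clear -l5; lia.
Qed.

(** Replacing [x] by [m] gives another hole. If [size m] were odd, this hole would be odd and as
    long as [C], so [m] would be a single vertex, against [local_jump_long]. *)
Lemma local_jump_even s x t r m (C := [:: s, x, t & r]) :
  hole G C -> odd (size C) -> local_jump C s x t m -> ~~ odd (size m).
Proof.
move=> h o lj; have sz := odd_hole_size h o.
have un := hole_uniq h.
have r0 : r != [::] by have : 3 < size C by [case: h]; rewrite /C; case: (r).
have fm : allrel far m r.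
  apply: (local_jump_far lj) => v vr; first by rewrite !inE vr !orbT.
  apply/negP=> vn; move: un; rewrite /C -[_ :: _]/([:: s; x; t] ++ r) cat_uniq.
  by case/and3P=> _ /hasPn/(_ _ vr); rewrite /= vn.
case: (lj) => _ ip _ _; have h' := hole_replace h r0 ip fm.
have := local_jump_long h o _ _ lj; rewrite !inE !eqxx !orbT => /(_ isT isT) m1.
apply/negP=> om; have := odd_hole_size h'; rewrite -sz.
have -> : size C = size r + 3 by rewrite addn3.
have -> : size (s :: m ++ t :: r) = size m + size r + 2.
  by rewrite /= size_cat /= addnS addn2.
have {}o : odd (size r + 3) by rewrite addn3.
move=> H; have : size m + size r + 2 = size r + 3 by apply: H; clear -om o; lia.
clear -m1; lia.
Qed.

(** If the jumps touched, switching from one to the other would connect the two distant triples,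
    against [no_connector]. Otherwise both can be made at once; both being even, the resulting hole
    is odd, yet it is longer than [C]. *)
Lemma no_two_local_jumps s x t r1 s' x' t' r2 P R
    (C := [:: s, x, t & r1 ++ [:: s', x', t' & r2]]) :
  hole G C -> odd (size C) -> r1 != [::] -> r2 != [::] ->
  local_jump C s x t P -> local_jump C s' x' t' R -> False.
Proof.
move=> h o r10 r20 lP lR; have sz := odd_hole_size h o; have un := hole_uniq h.
have fST : allrel far [:: s; x; t] [:: s'; x'; t'].
  have [e1 [r1' er1]] : exists e1 r1', r1 = e1 :: r1'.
    by case: (r1) r10 => // e1 r1' _; exists e1, r1'.
  have [e2 [r2' er2]] : exists e2 r2', r2 = e2 :: r2'.
    by case: (r2) r20 => // e2 r2' _; exists e2, r2'.
  have : hole G (([:: s; x; t] ++ e1 :: r1' ++ [:: s'; x'; t']) ++ e2 :: r2').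
    by move: h; rewrite /C er1 er2 /= -catA.
  move/hole_ipath; rewrite ipath_cat => /and3P[_ _]; rewrite allrel_catr.
  by case/andP.
have eC : C = [:: s; x; t] ++ r1 ++ [:: s'; x'; t'] ++ r2 by [].
have [sC tC] : s \in C /\ t' \in C by rewrite !(inE, mem_cat) !eqxx !orbT.
have [m0P ipP PC nbP] := lP; have [m0R ipR RC nbR] := lR.
have [fPR|] := boolP (allrel far P R); last first.
  rewrite /allrel -has_predC => /hasP[q qP]; rewrite /= -has_predC => /hasP[q' qR] /= nf.
  have [P1 [P2 eP]] := mem_split qP; have [R1 [R2 eR]] := mem_split qR.
  (* The connector follows [P] up to [q] and then [R] from [q'] on; if the jumps share this vertex,
     it is listed once. *)
  pose L := P1 ++ q :: (if q == q' then R2 else q' :: R2).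
  have subL v : v \in L -> v \in P \/ v \in R.
    rewrite mem_cat inE => /or3P[v1|/eqP->|v2].
    - by left; rewrite eP mem_cat v1.
    - by left.
    - right; rewrite eR mem_cat inE; move: v2; case: (q == q') => [->|]; rewrite ?orbT //.
      by rewrite inE => ->; rewrite orbT.
  have pL : path (adj G) s L.
    have pP := ipath_sorted ipP; have pR := ipath_sorted ipR; move: pP pR.
    rewrite /= !rcons_path eP eR !cat_path /= => /andP[/and3P[h1 h2 _] _] /andP[/and3P[_ _ h3] _].
    rewrite h1 h2 /=; case: eqP => [->//|/eqP ne] /=; rewrite h3 andbT.
    by move: nf; rewrite /far ne /= negbK.
  have lL : last s L = last s' R.
    rewrite /L eR !last_cat /=; by case: eqP => [->|].
  have lt' : adj G (last s' R) t'.
    by have := ipath_sorted ipR; rewrite /= rcons_path => /andP[].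
  have [p [m eL]] : exists p m, L = p :: m.
    by rewrite /L; case: (P1) => [|p m]; [eexists; eexists | exists p; eexists].
  rewrite eL in pL lL subL; move: pL => /= /andP[sp pm].
  apply: (@no_connector C (mem [:: s; x; t]) (mem [:: s'; x'; t']) p m) => //.
  - by move=> v /subL[/PC|/RC].
  - by exists s; rewrite adj_sym /= !inE eqxx.
  - by exists t'; rewrite /= !inE eqxx !orbT; split=> //; move: lL => /= ->.
  - by move=> v w /subL[vP|vR] wC vw /=; [rewrite (nbP v) | rewrite (nbR v) ?orbT].
  - by move=> c d _ _ /= cN dN; move/allrelP: fST; apply.
have lr v : v \in r1 ++ [:: s', x', t' & r2] -> v \notin [:: s; x; t].
  move=> vr; apply/negP=> vn; move: un; rewrite eC cat_uniq.
  by case/and3P=> _ /hasPn/(_ _ vr); rewrite /= vn.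
have h1 : hole G (s :: P ++ t :: r1 ++ [:: s', x', t' & r2]).
  apply: (hole_replace h) => //; first by case: (r1).
  apply: (local_jump_far lP) => v; last exact: lr.
  by rewrite /C !in_cons => ->; rewrite !orbT.
have eC2 : perm_eq C ([:: s'; x'; t'] ++ r2 ++ [:: s; x; t] ++ r1).
  by apply/permP=> Q; rewrite eC !count_cat; clear; lia.
have h2 : hole G ([:: s'; x'; t'] ++ r2 ++ [:: s; x; t] ++ r1).
  by move: h; rewrite eC catA => /hole_rotC; rewrite -!catA.
have szC2 : size ([:: s'; x'; t'] ++ r2 ++ [:: s; x; t] ++ r1) = size C.
  by rewrite (perm_size eC2).
have lR2 : local_jump ([:: s'; x'; t'] ++ r2 ++ [:: s; x; t] ++ r1) s' x' t' R.
  exact: local_jump_mem (perm_mem eC2) lR.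
have ev1 := local_jump_even h o lP.
have ev2 : ~~ odd (size R) by apply: (local_jump_even h2) => //; rewrite szC2.
have lP1 := local_jump_long h o sC _ lP.
have {}lP1 : 1 < size P by apply: lP1; rewrite !inE eqxx !orbT.
have lR1 : 0 < size R by rewrite lt0n size_eq0.
(* The second replacement is made in the hole left by the first one, rotated to start at [s']. *)
have h3 : hole G (s' :: R ++ t' :: r2 ++ [:: s & P ++ t :: r1]).
  apply: (@hole_replace s' x' t').
  - have := hole_rotC (s1 := s :: P ++ t :: r1) (s2 := [:: s', x', t' & r2]).
    by rewrite /= -!catA /=; apply.
  - by case: (r2) r20.
  - exact: ipR.
  - rewrite allrel_catr allrel_consr allrel_catr allrel_consr.
    have : allrel far R (r2 ++ [:: s; x; t] ++ r1).
      apply: (local_jump_far lR2) => v vr; first by rewrite mem_cat vr orbT.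
      apply/negP=> vn; have := hole_uniq h2; rewrite cat_uniq.
      by case/and3P=> _ /hasPn/(_ _ vr); rewrite /= vn.
    rewrite !allrel_catr !allrel_consr allrel0r andbT -!andbA => /and5P[-> -> _ -> ->].
    by rewrite allrel_farC fPR.
have szC : size C = size r1 + size r2 + 6 by rewrite /= size_cat /=; clear; lia.
have := odd_hole_size h3; rewrite -sz szC; rewrite szC in o.
have -> : size (s' :: R ++ t' :: r2 ++ s :: P ++ t :: r1) =
    size R + size r2 + size P + size r1 + 4.
  by rewrite /= !size_cat /= !size_cat /= size_cat /=; clear; lia.
move=> H; have : size R + size r2 + size P + size r1 + 4 = size r1 + size r2 + 6.
  by apply: H; clear -ev1 ev2 o; lia.
clear -lP1 lR1; lia.
Qed.

End LocalJumps.

(** * Contradiction from two distant local jumps *)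

Theorem theorem4p6 (l : nat) (hl : 5 <= l)
  (T : finType) (G : sgraph T)
  (hgirth : has_girth G (2 * l + 1))
  (hodd : ~ exists c : seq T, odd_hole G c /\ 2 * l + 3 <= size c)
  (C : seq T) (hC : odd_hole G C) :
  has_odd_K4_subdivision G \/
  has_balanced_K4_subdivision_12 G \/
  has_P3_cut G \/
  (exists v : T, v \in verts G /\ deg G v = 2).
Proof.
case: (classic (has_odd_K4_subdivision G \/ has_balanced_K4_subdivision_12 G)) => [[|]|no_K4].
- by left.
- by right; left.
case: (classic (has_P3_cut G)) => [|no_P3]; first by right; right; left.
case: (classic (exists v : T, v \in verts G /\ deg G v = 2)) => [|no_deg2].
  by right; right; right.
exfalso.
have girth c : gcycle G c -> 2 * l + 1 <= size c by case: hgirth => _; apply.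
have ohs c : hole G c -> odd (size c) -> size c = 2 * l + 1.
  move=> h o; case: (h) => /girth g _ _.
  have : ~~ (2 * l + 3 <= size c) by apply/negP=> b; apply: hodd; exists c.
  by move: (size c) o g => n; clear; lia.
case: hC => h o; have sz := ohs _ h o.
(* A first jump, found at the second vertex of the hole, goes forwards or backwards; rotating or
   reversing the hole makes it span the first three vertices. *)
have [s [x [t [r [m [h' o' lj]]]]]] : exists s x t r m,
    [/\ hole G [:: s, x, t & r], odd (size [:: s, x, t & r]) &
        local_jump G [:: s, x, t & r] s x t m].
  have [y1 [y [y2 [e1 [e3 [r [e2 eC]]]]]]] : exists y1 y y2 e1 e3 r e2,
      C = [:: y1, y, y2, e1, e3 & rcons r e2].
    case: (C) sz => [|y1 [|y [|y2 [|e1 [|e3 [|e4 r]]]]]] /=; try by clear -hl; lia.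
    by exists y1, y, y2, e1, e3, (belast e4 r), (last e4 r); rewrite -lastI.
  rewrite eC in h o.
  case: (@local_jump_exists T G l hl girth ohs no_K4 no_P3 no_deg2 y1 y y2 e1 (e3 :: r) e2) => // -[m lj].
    exists y, y2, e1, (e3 :: rcons (rcons r e2) y1), m; split.
    - by have := hole_rot 1 h; rewrite rot1_cons.
    - by move: o; rewrite /= !size_rcons.
    - apply: local_jump_mem lj => v; rewrite !(inE, mem_rcons).
      by case: (v == y1); rewrite ?orbT.
  exists y, y1, e2, (rcons (rcons (rev (e3 :: r)) e1) y2), m; split.
  - have -> : [:: y, y1, e2 & rcons (rcons (rev (e3 :: r)) e1) y2] =
        [:: y; y1] ++ rev [:: y2, e1, e3 & rcons r e2].
      by rewrite !rev_cons rev_rcons.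
    apply: hole_rotC; rewrite -[[:: y; y1]]/(rev [:: y1; y]) -rev_cat.
    exact: hole_rev.
  - by move: o; rewrite /= !size_rcons size_rev.
  - apply: local_jump_mem lj => v; rewrite !(in_cons, mem_rcons, mem_rev).
    by case: (v == y1); case: (v == y); case: (v == y2); case: (v == e1); case: (v == e2); case: (v == e3).
have sz' := ohs _ h' o'.
have [v3 [v4 [v5 [v6 [v7 [v8 [v9 [r' er]]]]]]]] : exists v3 v4 v5 v6 v7 v8 v9 r',
    r = [:: v3, v4, v5, v6, v7, v8, v9 & r'].
  move: sz'; case: (r) => [|v3 [|v4 [|v5 [|v6 [|v7 [|v8 [|v9 r']]]]]]] /=; try by clear -hl; lia.
  by exists v3, v4, v5, v6, v7, v8, v9, r'.
rewrite er in h' o' lj.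
(* The hole is read from [v5] so that the second jump starts at [v6] and ends at [v8] or [v4]. In
   either case [v3] and [v9] separate its triple from [s], [x], [t]. *)
pose D := [:: v5, v6, v7, v8 & rcons (v9 :: r' ++ [:: s; x; t; v3]) v4].
have eD : D = [:: v5, v6, v7, v8, v9 & r'] ++ [:: s; x; t; v3; v4].
  by rewrite /D -cats1 /= -catA.
have pD : perm_eq D [:: s, x, t, v3, v4, v5, v6, v7, v8, v9 & r'].
  by rewrite eD perm_catC.
have hD : hole G D.
  by rewrite eD; apply: hole_rotC.
have oD : odd (size D) by rewrite (perm_size pD).
have [[m2 lj2]|[m2 lj2]] :=
  local_jump_exists hl girth ohs no_K4 no_P3 no_deg2 hD oD isT.
  apply: (@no_two_local_jumps T G l hl girth ohs no_K4 no_P3 no_deg2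
     s x t [:: v3; v4; v5] v6 v7 v8 (v9 :: r') m m2 h' o' isT isT lj).
  exact: local_jump_mem (perm_mem pD) lj2.
apply: (@no_two_local_jumps T G l hl girth ohs no_K4 no_P3 no_deg2
   s x t [:: v3] v4 v5 v6 [:: v7, v8, v9 & r'] m (rev m2) h' o' isT isT lj).
exact: local_jump_mem (perm_mem pD) (local_jump_flip lj2).
Qed.
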